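(* Let $\mu$ be a non-negative Borel measure on $[0,\infty)$, put $M(t)=\int_{[0,t]}\mu(ds)$ for $t\ge 0$, and suppose $M(t)<\infty$ for all $t\ge 0$, $\lim_{t\to\infty}M(t)=\infty$ and $M\in \mathrm{RV}_\infty(\theta)$ for some $\theta\ge 0$. Let $f\in \mathrm{RV}_\infty(\beta)$ with $\beta\in[0,1)$; when $\beta=0$ suppose in addition that $f$ is asymptotically increasing and $\lim_{x\to\infty}f(x)=\infty$. Let $H(t)=\int_0^t h(s)\,ds$ satisfy $H\in C((0,\infty);(0,\infty))$, let $\xi>0$, and let $x$ denote the continuous solution of $$x'(t)=\int_{[0,t]}\mu(ds)\,f(x(t-s))+h(t),\quad t>0;\qquad x(0)=\xi.$$ Let $F(x)=\int_1^x\frac{du}{f(u)}$ for $x>0$, and $$L=\left\{\frac{1}{1-\beta}B\left(1+\theta,\tfrac{1+\theta\beta}{1-\beta}\right)\right\}^{\frac1{1-\beta}}.$$ Then the following are equivalent: (i) $\displaystyle\lim_{t\to\infty}\frac{x(t)}{F^{-1}(t\,M(t))}=\zeta$ for some $\zeta\in[L,\infty)$; (ii) $\displaystyle\lim_{t\to\infty}\frac{H(t)}{F^{-1}(t\,M(t))}=\lambda$ for some $\lambda\in[0,\infty)$. Moreover, in this case $$\zeta=\frac{\zeta^\beta}{1-\beta}\,B\left(1+\theta,\tfrac{1+\theta\beta}{1-\beta}\right)+\lambda.$$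
   Context: $\mathrm{RV}_\infty(\rho)$ ($\rho\in\mathbb{R}$) denotes the class of measurable functions $g$, positive for all sufficiently large arguments, with $\lim_{x\to\infty}g(\lambda x)/g(x)=\lambda^\rho$ for every $\lambda>0$. The function $f:[0,\infty)\to[0,\infty)$ is continuous and positive on $(0,\infty)$. Write $a(x)\sim b(x)$ if $a(x)/b(x)\to1$ as $x\to\infty$. ''$f$ asymptotically increasing'' means there is $\phi\in C^1((0,\infty);(0,\infty))\cap C([0,\infty);(0,\infty))$ with $\phi'(x)>0$ for all $x>0$ and $f(x)\sim\phi(x)$ as $x\to\infty$. $B(p,q)=\int_0^1 u^{p-1}(1-u)^{q-1}\,du$ is the Beta function. $F^{-1}$ is the inverse of the increasing function $F$ (whose range contains $[0,\infty)$). The function $h:[0,\infty)\to\mathbb{R}$ is locally integrable (not assumed positive), and the equation is understood in its equivalent integral form $x(t)=\xi+\int_0^t M(t-s)f(x(s))\,ds+H(t)$, $t\ge 0$. Existence and uniqueness of the continuous positive solution on $[0,\infty)$ is part of the standing framework and is taken as given. *)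

(* Defs.v *)
From HB Require Import structures.
From mathcomp Require Import all_boot all_order all_algebra.
From mathcomp Require Import all_classical all_reals all_analysis.

Set Implicit Arguments.
Unset Strict Implicit.
Unset Printing Implicit Defensive.

Import Order.TTheory GRing.Theory Num.Theory.
Import numFieldNormedType.Exports.

Local Open Scope classical_set_scope.
Local Open Scope ring_scope.

(* Functions on [0, oo) are total functions R -> R
   whose values at negative arguments are never constrained nor used. *)

Definition regularly_varying (R : realType) (rho : R) (g : R -> R) : Prop :=
  [/\ measurable_fun (`[0, +oo[ : set R) g,
      \forall x \near +oo, 0 < g x &
      forall l : R, 0 < l -> g (l * x) / g x @[x --> +oo] --> l `^ rho].

Definition asymp_equiv (R : realType) (a b : R -> R) : Prop :=
  a x / b x @[x --> +oo] --> (1 : R).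

Definition asymp_increasing (R : realType) (f : R -> R) : Prop :=
  exists phi : R -> R,
    [/\ {within `[0, +oo[, continuous phi} /\ (forall x, 0 <= x -> 0 < phi x),
        forall x, 0 < x -> derivable phi x 1,
        {in `]0, +oo[, continuous (phi^`())%classic},
        forall x, 0 < x -> 0 < (phi^`())%classic x &
        asymp_equiv f phi].

(* [beta_fun] of the library only takes natural number parameters. *)
Definition Beta (R : realType) (p q : R) : R :=
  \int[lebesgue_measure]_(u in `[0, 1]) (u `^ (p - 1) * (1 - u) `^ (q - 1)).

(* [locally_integrable] of the library requires an open domain. *)
Definition locally_integrable_halfline (R : realType) (h : R -> R) : Prop :=
  forall T : R, 0 <= T -> lebesgue_measure.-integrable `[0, T] (EFin \o h).

Definition primitive0 (R : realType) (h : R -> R) (t : R) : R :=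
  \int[lebesgue_measure]_(s in `[0, t]) h s.

Definition cumul (R : realType)
    (mu : {measure set (measurableTypeR R) -> \bar R}) (t : R) : R :=
  fine (mu `[0, t]%classic).

(* The library integral is unoriented, hence the sign for x < 1. *)
Definition Fint (R : realType) (f : R -> R) (x : R) : R :=
  if 1 <= x then \int[lebesgue_measure]_(u in `[1, x]) (f u)^-1
  else - \int[lebesgue_measure]_(u in `[x, 1]) (f u)^-1.

(* The inverse of F : (0, oo) -> R; it is 0 outside the range of F. *)
Definition Finv (R : realType) (f : R -> R) : R -> R :=
  'pinv_(fun=> 0) `]0, +oo[ (Fint f).

Definition is_solution (R : realType) (M f H : R -> R) (xi : R) (x : R -> R)
    : Prop :=
  [/\ {within `[0, +oo[, continuous x},
      forall t, 0 <= t -> 0 < x t,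
      x 0 = xi &
      forall t, 0 <= t ->
        x t = xi
          + \int[lebesgue_measure]_(s in `[0, t]) (M (t - s) * f (x s))
          + H t].

Definition Lconst (R : realType) (theta beta : R) : R :=
  ((1 - beta)^-1 * Beta (1 + theta) ((1 + theta * beta) / (1 - beta)))
    `^ (1 - beta)^-1.

(* Main.v *)
Require Import Defs.
From HB Require Import structures.
From mathcomp Require Import all_boot all_order all_algebra.
From mathcomp Require Import all_classical all_reals all_analysis.
From mathcomp Require Import measurable_realfun ring lra.

Import Order.TTheory GRing.Theory Num.Theory.
Import numFieldNormedType.Exports.

Local Open Scope classical_set_scope.
Local Open Scope ring_scope.

(** Write [M] for the distribution function of [mu], [a t = F^-1 (t M t)] and
    [K = B / (1 - beta)].  The function [f] is equivalent to a nondecreasing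
    [phi]: for [beta = 0] by assumption, for [beta > 0] by the uniform
    convergence theorem, obtained here from Baire's theorem.  With [phi]
    monotone, Karamata's theorem [x / (phi x F x) --> 1 - beta] reduces to
    comparing increments of [F], [a] is regularly varying of index
    [(1 + theta) / (1 - beta)], and squeezing between Riemann sums gives
    [\int_0^t M (t - s) phi (c a s) ds ~ c^beta K a t] for every [c > 0].
    Hence [c a <= x] eventually makes the memory term at least about
    [c^beta K a], and [x <= c a] at most that, which yields
    [(i) -> (ii)] and the equation.

    For [(ii) -> (i)], a time-shifted multiple of [a] is a subsolution and
    another one is a supersolution, so [l = liminf x / a > 0] and
    [u = limsup x / a < oo].  The comparison gives [l >= g l] and [u <= g u] for
    [g z = K z^beta + lambda], and since [beta < 1] this forces [l = u]. *)

Set Implicit Arguments.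
Unset Strict Implicit.
Unset Printing Implicit Defensive.

(** * Ratio limits of monotone functions *)

(** Since [M] may jump, [a] is nondecreasing but need not be continuous, and [f] is only equivalent
    to a monotone function. Limits are therefore split into one-sided bounds, and monotonicity does
    the work of uniform convergence; the functions compared are extended to monotone functions on
    the whole line.

    The constants have two sources. Karamata's theorem at [a t], where [F (a t) = t M t], turns
    [t M t phi (a t)] into about [a t / (1 - beta)], the factor in [K]. The index of [phi (c a t)]
    is [beta (1 + theta) / (1 - beta)], and adding 1 to it gives the second argument of Beta.

    The delicate point of the converse is the pair of bounds [l > 0] and [u < oo]: for
    [lambda = 0 < beta] the map [g] also fixes 0, so [g l <= l] alone does not exclude the value 0.
    Once [0 < l <= u < oo], scaling the argument of [g] by [r < 1] scales the value by more than
    [r], so that only one fixed point remains. [L] is this fixed point for [lambda = 0], which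
    explains the range of [zeta]. *)

Lemma cvg_pinfty_between (R : realType) (u : R -> R) (l : R) :
  (forall m, m < l -> \forall t \near +oo, m <= u t) ->
  (forall m, l < m -> \forall t \near +oo, u t <= m) ->
  u t @[t --> +oo] --> l.
Proof.
move=> lo hi; apply/cvgrPdist_le => e e0.
have lo' : l - e < l by lra.
have hi' : l < l + e by lra.
near=> t; rewrite ler_distlC; apply/andP; split.
  by near: t; exact: lo.
by near: t; exact: hi.
Unshelve. all: by end_near. Qed.

Lemma powR_continuous (R : realType) (b c : R) : 0 < c ->
  {for c, continuous (@powR R ^~ b)}.
Proof.
move=> c0; apply: differentiable_continuous; apply/derivable1_diffP.
by apply: derivable_powR; rewrite in_itv/= andbT.
Qed.

Lemma powR_approx_lt (R : realType) (b c m : R) : 0 < c -> m < c `^ b ->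
  exists d : R, [/\ 0 < d, d < c & m < d `^ b].
Proof.
move=> c0 mc.
have H : \forall y \near c, m < y `^ b.
  exact: (cvgr_gt _ (powR_continuous c0) _ mc).
have H2 : \forall y \near c^'-, [/\ 0 < y, y < c & m < y `^ b].
  near=> y; split; near: y; first exact: nbhs_left_gt.
    exact: nbhs_left_lt.
  exact: cvg_at_left_filter H.
by have [y ?] := @filter_ex _ _ _ _ H2; exists y.
Unshelve. all: by end_near. Qed.

Lemma powR_approx_gt (R : realType) (b c m : R) : 0 < c -> c `^ b < m ->
  exists d : R, [/\ c < d & d `^ b < m].
Proof.
move=> c0 mc.
have H : \forall y \near c, y `^ b < m.
  exact: (cvgr_lt _ (powR_continuous c0) _ mc).
have H2 : \forall y \near c^'+, [/\ c < y & y `^ b < m].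
  near=> y; split; near: y; first exact: nbhs_right_gt.
  exact: cvg_at_right_filter H.
by have [y ?] := @filter_ex _ _ _ _ H2; exists y.
Unshelve. all: by end_near. Qed.

(* Monotonicity replaces the uniform convergence theorem here. *)
Lemma mono_ratio_cvg (R : realType) (b c : R) (g u v : R -> R) :
  {homo g : x y / x <= y} -> (\forall x \near +oo, 0 < g x) ->
  (forall l, 0 < l -> g (l * x) / g x @[x --> +oo] --> l `^ b) ->
  v t @[t --> +oo] --> +oo -> 0 < c ->
  u t / v t @[t --> +oo] --> c ->
  g (u t) / g (v t) @[t --> +oo] --> c `^ b.
Proof.
move=> gm gp grv vy c0 uv.
have vp : \forall t \near +oo, 0 < v t.
  by have /cvgryPgt := vy; exact.
have gvp : \forall t \near +oo, 0 < g (v t) := vy _ gp.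
apply: cvg_pinfty_between => m mc.
- have [d [d0 dc md]] := powR_approx_lt c0 mc.
  have grd : \forall t \near +oo, m < g (d * v t) / g (v t).
    exact: (vy _ (cvgr_gt _ (grv d d0) _ md)).
  have uvd : \forall t \near +oo, d < u t / v t by exact: (cvgr_gt _ uv _ dc).
  near=> t.
  have H1 : 0 < v t by near: t.
  have H2 : 0 < g (v t) by near: t.
  have H3 : m < g (d * v t) / g (v t) by near: t.
  have H4 : d < u t / v t by near: t.
  apply: (le_trans (ltW H3)); rewrite ler_pM2r ?invr_gt0//; apply: gm.
  by rewrite -ler_pdivlMr// ltW.
- have [d [dc md]] := powR_approx_gt c0 mc.
  have d0 : 0 < d by exact: lt_trans dc.
  have grd : \forall t \near +oo, g (d * v t) / g (v t) < m.
    exact: (vy _ (cvgr_lt _ (grv d d0) _ md)).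
  have uvd : \forall t \near +oo, u t / v t < d by exact: (cvgr_lt _ uv _ dc).
  near=> t.
  have H1 : 0 < v t by near: t.
  have H2 : 0 < g (v t) by near: t.
  have H3 : g (d * v t) / g (v t) < m by near: t.
  have H4 : u t / v t < d by near: t.
  apply: (le_trans _ (ltW H3)); rewrite ler_pM2r ?invr_gt0//; apply: gm.
  by rewrite -ler_pdivrMr// ltW.
Unshelve. all: by end_near. Qed.

Lemma powR_lt_root (R : realType) (k c d : R) : 0 < k -> 0 < c -> 0 < d ->
  (d < c `^ k^-1) = (d `^ k < c).
Proof.
move=> k0 c0 d0; have k0' : 0 < k^-1 by rewrite invr_gt0.
have e : d = (d `^ k) `^ k^-1 by rewrite -powRrM divff ?gt_eqF// powRr1// ltW.
rewrite {1}e; apply/idP/idP; last first.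
  by apply: gt0_ltr_powR => //; rewrite ?nnegrE ?powR_ge0// ltW.
apply: contraTT; rewrite -!leNgt.
by apply: ge0_ler_powR; rewrite ?nnegrE ?powR_ge0// ltW.
Qed.

Lemma powR_gt_root (R : realType) (k c d : R) : 0 < k -> 0 < c -> 0 < d ->
  (c `^ k^-1 < d) = (c < d `^ k).
Proof.
move=> k0 c0 d0; have k0' : 0 < k^-1 by rewrite invr_gt0.
have e : d = (d `^ k) `^ k^-1 by rewrite -powRrM divff ?gt_eqF// powRr1// ltW.
rewrite {1}e; apply/idP/idP; last first.
  by apply: gt0_ltr_powR => //; rewrite ?nnegrE ?powR_ge0// ltW.
apply: contraTT; rewrite -!leNgt.
by apply: ge0_ler_powR; rewrite ?nnegrE ?powR_ge0// ltW.
Qed.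

(** Regular variation read backwards: if, say, [u t < m * v t] with [m^k < c], then
    [g (u t) <= g (m * v t)], whose ratio to [g (v t)] tends to [m^k], too small for the limit [c].
    This is what inverts [F] in [growth_rv]; [k > 0] makes the power strictly monotone. *)
Lemma mono_ratio_cvg_inv (R : realType) (k c : R) (g u v : R -> R) :
  {homo g : x y / x <= y} -> (\forall x \near +oo, 0 < g x) ->
  (forall l, 0 < l -> g (l * x) / g x @[x --> +oo] --> l `^ k) -> 0 < k ->
  v t @[t --> +oo] --> +oo -> (\forall t \near +oo, 0 < u t) -> 0 < c ->
  g (u t) / g (v t) @[t --> +oo] --> c ->
  u t / v t @[t --> +oo] --> c `^ k^-1.
Proof.
move=> gm gp grv k0 vy up c0 guv.
have vp : \forall t \near +oo, 0 < v t.
  by have /cvgryPgt := vy; exact.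
have gvp : \forall t \near +oo, 0 < g (v t) := vy _ gp.
apply: cvg_pinfty_between => m mc.
- have [m0|m0] := leP m 0.
    near=> t; apply: (le_trans m0); apply: divr_ge0; apply: ltW; near: t => //.
  have mc' : m `^ k < c by rewrite -powR_lt_root.
  have [d md dc] : exists2 d, m `^ k < d & d < c.
    by exists ((m `^ k + c) / 2); lra.
  have grd : \forall t \near +oo, g (m * v t) / g (v t) < d.
    exact: (vy _ (cvgr_lt _ (grv m m0) _ md)).
  have uvd : \forall t \near +oo, d < g (u t) / g (v t) by exact: (cvgr_gt _ guv _ dc).
  near=> t.
  have H1 : 0 < v t by near: t.
  have H2 : 0 < g (v t) by near: t.
  have H3 : g (m * v t) / g (v t) < d by near: t.
  have H4 : d < g (u t) / g (v t) by near: t.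
  rewrite ler_pdivlMr// leNgt; apply/negP => /ltW/gm.
  have := lt_trans H3 H4; rewrite ltr_pM2r ?invr_gt0// => h.
  by rewrite leNgt h.
- have m0 : 0 < m by apply: le_lt_trans mc; exact: powR_ge0.
  have mc' : c < m `^ k by rewrite -powR_gt_root.
  have [d md dc] : exists2 d, d < m `^ k & c < d.
    by exists ((m `^ k + c) / 2); lra.
  have grd : \forall t \near +oo, d < g (m * v t) / g (v t).
    exact: (vy _ (cvgr_gt _ (grv m m0) _ md)).
  have uvd : \forall t \near +oo, g (u t) / g (v t) < d by exact: (cvgr_lt _ guv _ dc).
  near=> t.
  have H1 : 0 < v t by near: t.
  have H2 : 0 < g (v t) by near: t.
  have H3 : d < g (m * v t) / g (v t) by near: t.
  have H4 : g (u t) / g (v t) < d by near: t.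
  rewrite ler_pdivrMr// leNgt; apply/negP => /ltW/gm.
  have := lt_trans H4 H3; rewrite ltr_pM2r ?invr_gt0// => h.
  by rewrite leNgt h.
Unshelve. all: by end_near. Qed.

(** * Regularly varying functions are almost increasing *)

(** The set [E n] of the [u] whose increments are [e / 2]-close from [n] on is closed, as [k] is
    continuous, and these sets cover the line by pointwise convergence. By Baire one of them
    contains a ball around some [u0]. The increment by [v] from [x] is the difference of those by
    [u0 + v] and [u0] from [x - u0]. *)
Lemma cvg_increment_uniform (R : realType) (b : R) (k : R -> R) :
  continuous k ->
  (forall u : R, k (x + u) - k x @[x --> +oo] --> b * u) ->
  forall e : R, 0 < e -> exists d X : R, 0 < d /\
    forall x v : R, X <= x -> `|v| <= d -> `|k (x + v) - k x - b * v| <= e.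
Proof.
move=> kc kl e e0.
pose g x u : R := `|k (x + u) - k x - b * u|.
pose E (n : nat) := [set u | forall x, n%:R <= x -> g x u <= e / 2].
have Ecl n : closed (E n).
  have -> : E n = \bigcap_(x in [set x : R | n%:R <= x])
      (g x @^-1` [set y | y <= e / 2]) by [].
  apply: closed_bigI => x _; apply: closed_comp; last exact: closed_le.
  move=> u _; rewrite /g; apply: cvg_norm; apply: cvgB; last exact: mulrl_continuous.
  apply: cvgB; last exact: cvg_cst.
  apply: continuous_comp; last exact: kc.
  by apply: cvgD; [exact: cvg_cst|exact: cvg_id].
have [n [V [[u0 Vu0] oV VE]]] :
    exists n (V : set R), [/\ V !=set0, open V & V `<=` E n].
  apply: contrapT => H.
  have dE n : open (~` E n) /\ dense (~` E n).
    split; first by rewrite openC.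
    move=> V V0 oV; apply: contrapT => K; apply: H; exists n, V; split=> // z Oz.
    by apply: contrapT => nE; apply: K; exists z.
  have [|u [_ uE]] := @Baire R R^o _ dE setT _ openT; first by exists 0.
  have e2 : 0 < e / 2 by lra.
  have /cvgrPdistC_le/(_ (e / 2) e2) [X [_ HX]] := kl u.
  pose n := (Num.truncn `|X|).+1.
  have [|]// := uE n => z nz; rewrite /g.
  apply: HX; apply: (lt_le_trans _ nz); apply: (le_lt_trans (ler_norm X)).
  exact: truncnS_gt.
have /nbhs_ballP[r /= r0 rV] : nbhs u0 V by exact: open_nbhs_nbhs.
exists (r / 2), (n%:R + u0); split; first lra.
move=> x v nx vr.
have nxu : n%:R <= x - u0 by lra.
have H1 : g (x - u0) u0 <= e / 2 by exact: (VE _ Vu0).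
have H2 : g (x - u0) (u0 + v) <= e / 2.
  apply: VE => //; apply: rV; rewrite /ball/= opprD addrA subrr sub0r normrN.
  lra.
have -> : k (x + v) - k x - b * v = (k (x - u0 + (u0 + v)) - k (x - u0) - b * (u0 + v))
   - (k (x - u0 + u0) - k (x - u0) - b * u0).
  by rewrite addrA subrK; ring.
apply: (le_trans (ler_normB _ _)).
rewrite /g in H1 H2; lra.
Qed.

(** The increment over the fixed step [d] tends to [b * d > 0], so going back from [x] in steps of
    [d] only lowers [k]. The last piece, shorter than [d], costs at most [e] by the uniform
    estimate. The induction counts the steps. *)
Lemma increments_almost_increasing (R : realType) (b : R) (k : R -> R) :
  0 < b -> continuous k ->
  (forall u : R, k (x + u) - k x @[x --> +oo] --> b * u) ->
  forall e : R, 0 < e ->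
  exists X : R, forall y x : R, X <= y -> y <= x -> k y <= k x + e.
Proof.
move=> b0 kc kl e e0.
have [d [X0 [d0 HX0]]] := cvg_increment_uniform kc kl e0.
have bd0 : 0 < b * d by exact: mulr_gt0.
have [X1 [_ HX1]] := cvgr_gt _ (kl d) _ bd0.
(* A neighbourhood of [+oo] provides a strict lower bound; the [+ 1] makes it usable with [<=], here
   and below. *)
pose X := Num.max X0 (X1 + 1).
exists X => y x0 Xy yx0.
have X0y : X0 <= y by apply: le_trans Xy; rewrite le_max lexx.
have X1y : X1 < y.
  by apply: (@lt_le_trans _ _ X) => //; rewrite lt_max; apply/orP; right; lra.
suff H (n : nat) : forall x, y <= x -> x <= y + n%:R * d -> k y <= k x + e.
  apply: (H (Num.truncn ((x0 - y) / d)).+1) => //.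
  by rewrite -lerBlDl -ler_pdivrMr// ltW// truncnS_gt.
elim: n => [|n IH] x yx.
  rewrite mul0r addr0 => xy; have -> : x = y by apply/eqP; rewrite eq_le xy.
  by rewrite lerDl ltW.
rewrite -natr1 mulrDl mul1r => xn.
have [xy|xy] := leP x (y + d).
  have /(HX0 x) : `|y - x| <= d by rewrite ler_norml; apply/andP; split; lra.
  move=> /(_ (le_trans X0y yx)); rewrite ler_norml subrKC => /andP[_ h].
  have h' : b * (y - x) <= 0 by apply: mulr_ge0_le0; lra.
  lra.
have : 0 < k (x - d + d) - k (x - d) by apply: HX1; lra.
rewrite subrK => h.
have h' : k y <= k (x - d) + e by apply: IH; lra.
lra.
Qed.

Lemma expR_cvgy (R : realType) : @expR R x @[x --> +oo] --> +oo.
Proof.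
apply/cvgryPge => A; near=> x; apply: le_trans (expR_ge1Dx x).
by rewrite -lerBlDl; near: x; apply: nbhs_pinfty_ge; rewrite num_real.
Unshelve. all: by end_near. Qed.

(** In logarithmic coordinates, [k = ln o f o exp], the ratios become increments with limit [b * u],
    and an additive error [ln (1 + e)] becomes the factor [1 + e]. *)
Lemma rv_almost_increasing (R : realType) (b : R) (f : R -> R) : 0 < b ->
  {in `]0, +oo[, continuous f} -> (forall u : R, 0 < u -> 0 < f u) ->
  (forall l : R, 0 < l -> f (l * x) / f x @[x --> +oo] --> l `^ b) ->
  forall e : R, 0 < e -> exists X : R, 0 < X /\
    forall y x : R, X <= y -> y <= x -> f y <= (1 + e) * f x.
Proof.
move=> b0 fc fp frv e e0.
pose k x := ln (f (expR x)).
have kc : continuous k.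
  move=> x; apply: continuous_comp; last first.
    by apply: continuous_ln; apply: fp; exact: expR_gt0.
  apply: continuous_comp; first exact: continuous_expR.
  by apply: fc; rewrite in_itv/= expR_gt0.
have kl u : k (x + u) - k x @[x --> +oo] --> b * u.
  have -> : b * u = ln (expR u `^ b) by rewrite ln_powR expRK.
  have -> : (fun x => k (x + u) - k x) =
      @ln R \o (fun x => f (expR u * x) / f x) \o @expR R.
    apply/funext => x /=; rewrite /k expRD ln_div ?posrE ?fp ?mulr_gt0 ?expR_gt0//.
    by rewrite (mulrC (expR x)).
  apply: cvg_comp; first exact: expR_cvgy.
  apply: cvg_comp; first by apply: frv; exact: expR_gt0.
  by apply: continuous_ln; apply: powR_gt0; exact: expR_gt0.
have le0 : 0 < ln (1 + e) by apply: ln_gt0; lra.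
have [X HX] := increments_almost_increasing b0 kc kl le0.
exists (expR X); split; first exact: expR_gt0.
move=> y x Xy yx.
have y0 : 0 < y by apply: lt_le_trans Xy; exact: expR_gt0.
have x0 : 0 < x by exact: lt_le_trans yx.
have := HX (ln y) (ln x); rewrite /k !lnK ?posrE//.
have Xly : X <= ln y by rewrite -[X]expRK ler_ln ?posrE ?expR_gt0.
rewrite ler_ln ?posrE// => /(_ Xly yx).
have ?: 0 < 1 + e by lra.
by rewrite addrC -lnM ?posrE ?fp// ler_ln ?posrE ?mulr_gt0 ?fp.
Qed.

Lemma scale_cvgy (R : realType) (l : R) : 0 < l -> l * x @[x --> +oo] --> +oo.
Proof. by move=> l0; apply: gt0_cvgMry => //; exact: cvg_id. Qed.

Lemma rv_asymp_equiv (R : realType) (b : R) (f g : R -> R) :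
  (\forall x \near +oo, 0 < f x) -> (\forall x \near +oo, 0 < g x) ->
  f x / g x @[x --> +oo] --> (1 : R) ->
  (forall l : R, 0 < l -> f (l * x) / f x @[x --> +oo] --> l `^ b) ->
  forall l : R, 0 < l -> g (l * x) / g x @[x --> +oo] --> l `^ b.
Proof.
move=> fp gp fg frv l l0.
have fgl : f (l * x) / g (l * x) @[x --> +oo] --> (1 : R).
  exact: (cvg_comp _ _ (scale_cvgy l0) fg).
have -> : l `^ b = l `^ b * 1 * (1 : R)^-1 by rewrite invr1 !mulr1.
have fpl : \forall x \near +oo, 0 < f (l * x) := scale_cvgy l0 fp.
have gpl : \forall x \near +oo, 0 < g (l * x) := scale_cvgy l0 gp.
have H : f (l * x) / f x * (f x / g x) * (f (l * x) / g (l * x))^-1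
    @[x --> +oo] --> l `^ b * 1 * (1 : R)^-1.
  apply: cvgM; first by apply: cvgM => //; exact: frv.
  by apply: cvgV => //; rewrite oner_neq0.
apply: cvg_trans H; apply: near_eq_cvg; near=> x.
have H1 : 0 < f x by near: x.
have H2 : 0 < g x by near: x.
have H3 : 0 < f (l * x) by near: x.
have H4 : 0 < g (l * x) by near: x.
by field; rewrite !gt_eqF.
Unshelve. all: by end_near. Qed.

(** A bounded [g] would have a supremum [S > 0], and for a ratio bound [r > 1] one gets
    [g x <= g y <= g (l * y) / r <= S / r] with [y] large, hence [S <= S / r]. *)
Lemma mono_ratio_cvgy (R : realType) (l c : R) (g : R -> R) :
  {homo g : x y / x <= y} -> (\forall x \near +oo, 0 < g x) -> 1 < c -> 0 < l ->
  g (l * x) / g x @[x --> +oo] --> c -> g x @[x --> +oo] --> +oo.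
Proof.
move=> gm gp c1 l0 gl; apply/cvgryPge => A; apply: contrapT => nA.
have gA x : g x <= A.
  rewrite leNgt; apply/negP => Ax; apply: nA; near=> y.
  apply: (le_trans (ltW Ax)); apply: gm; near: y; apply: nbhs_pinfty_ge.
  by rewrite num_real.
pose S := sup (range g).
have gS x : g x <= S by apply: ub_le_sup; [exists A => _ [y _ <-]|exists x].
have r1 : 1 < (1 + c) / 2 by lra.
have gr : \forall x \near +oo, (1 + c) / 2 < g (l * x) / g x.
  by apply: cvgr_gt gl _ _; lra.
have [x0 gx0] := filter_ex gp.
have S0 : 0 < S by exact: lt_le_trans (gS x0).
have : S <= S / ((1 + c) / 2).
  apply: ge_sup; first by exists (g x0), x0.
  move=> _ [x _ <-].
  near (pinfty_nbhs R) => y.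
  have H1 : 0 < g y by near: y.
  have H2 : (1 + c) / 2 < g (l * y) / g y by near: y.
  have H3 : x <= y by near: y; apply: nbhs_pinfty_ge; rewrite num_real.
  apply: (le_trans (gm _ _ H3)); rewrite ler_pdivlMr; last lra.
  apply: le_trans (gS (l * y)); rewrite mulrC -ler_pdivlMr//; exact: ltW.
have : S * 1 < S * ((1 + c) / 2) by rewrite ltr_pM2l.
by rewrite ler_pdivlMr; lra.
Unshelve. all: by end_near. Qed.

(** [g x] is the infimum of [f] to the right of [x]. Cutting off at [X], the threshold for [e = 1],
    keeps this infimum above half of a value of [f], hence positive, also for arguments near 0 or
    negative. *)
Lemma almost_increasing_equiv (R : realType) (f : R -> R) :
  (forall u : R, 0 < u -> 0 < f u) ->
  (forall e : R, 0 < e -> exists X : R, 0 < X /\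
    forall y x : R, X <= y -> y <= x -> f y <= (1 + e) * f x) ->
  exists g : R -> R, [/\ {homo g : x y / x <= y}, forall x, 0 < g x &
    f x / g x @[x --> +oo] --> (1 : R)].
Proof.
move=> fp fi; have [X [X0 HX]] := fi 1 ltr01.
pose E x := f @` [set y | Num.max x X <= y].
have E0 x : E x !=set0 by exists (f (Num.max x X)), (Num.max x X) => /=.
have Elb x : lbound (E x) 0.
  move=> _ [y /= xy <-]; apply/ltW/fp; apply: (lt_le_trans X0).
  by apply: le_trans xy; rewrite le_max lexx orbT.
have Elb' x : has_lbound (E x) by exists 0; exact: Elb.
pose g x := inf (E x).
have gp x : 0 < g x.
  have m0 : 0 < Num.max x X by rewrite lt_max X0 orbT.
  apply: (@lt_le_trans _ _ (f (Num.max x X) / 2)).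
    by rewrite divr_gt0 ?fp.
  apply: lb_le_inf => // _ [y /= xy <-].
  rewrite ler_pdivrMr//.
  have Xm : X <= Num.max x X by rewrite le_max lexx orbT.
  have := HX _ _ Xm xy; lra.
exists g; split => //.
  move=> x y xy; apply: lb_le_inf => // _ [z /= yz <-]; apply: ge_inf => //.
  by exists z => //=; apply: le_trans yz; rewrite ge_max !le_max xy lexx orbT.
apply: cvg_pinfty_between => m m1.
- near=> x; apply: (le_trans (ltW m1)); rewrite ler_pdivlMr// mul1r.
  apply: ge_inf => //; exists x => //=; rewrite ge_max lexx/=.
  by near: x; apply: nbhs_pinfty_ge; rewrite num_real.
- have [|Y [Y0 HY]] := fi (m - 1); first lra.
  near=> x.
  have xY : Y <= x by near: x; apply: nbhs_pinfty_ge; rewrite num_real.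
  have m0 : 0 < m by lra.
  rewrite ler_pdivrMr// mulrC -ler_pdivrMr//.
  apply: lb_le_inf => // _ [y /= xy <-]; rewrite ler_pdivrMr// mulrC.
  have := HY x y xY; rewrite addrC subrK; apply.
  by apply: le_trans xy; rewrite le_max lexx.
Unshelve. all: by end_near. Qed.

Lemma asymp_increasing_equiv (R : realType) (f : R -> R) :
  asymp_increasing f ->
  exists g : R -> R, [/\ {homo g : x y / x <= y}, forall x, 0 < g x &
    f x / g x @[x --> +oo] --> (1 : R)].
Proof.
move=> [phi [[phic phip] phid _ phi' phif]].
(* The derivative of [phi] is controlled only on the positive axis; freezing [phi] to the left of 1
   gives a function that is monotone on the whole line. *)
exists (fun x => phi (Num.max 1 x)); split.
- move=> x y xy.
  have m0 (z : R) : 0 <= Num.max 1 z by rewrite le_max ler01.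
  apply: (@ger0_derive1_ndecr _ phi 0 (Num.max 1 y)) => //.
  + by move=> z; rewrite in_itv/= => /andP[z0 _]; exact: phid.
  + by move=> z; rewrite in_itv/= => /andP[z0 _]; apply/ltW/phi'.
  + by apply: continuous_subspaceW phic; exact: subset_itvl.
  + by rewrite ge_max !le_max lexx xy orbT.
- by move=> x; apply: phip; rewrite le_max ler01.
- apply: cvg_trans phif; apply: near_eq_cvg; near=> x.
  by rewrite max_r//; near: x; apply: nbhs_pinfty_ge; rewrite num_real.
Unshelve. all: by end_near. Qed.

Lemma rv_monotone_equiv (R : realType) (b : R) (f : R -> R) : 0 <= b ->
  {in `]0, +oo[, continuous f} -> (forall u : R, 0 < u -> 0 < f u) ->
  regularly_varying b f ->
  (b = 0 -> asymp_increasing f /\ f u @[u --> +oo] --> +oo) ->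
  exists g : R -> R, [/\ {homo g : x y / x <= y}, forall x, 0 < g x,
    f x / g x @[x --> +oo] --> (1 : R),
    g x @[x --> +oo] --> +oo &
    forall l : R, 0 < l -> g (l * x) / g x @[x --> +oo] --> l `^ b].
Proof.
move=> b0 fc fp [_ fp' frv] f0.
have gy (g : R -> R) : (forall x, 0 < g x) -> f x / g x @[x --> +oo] --> (1 : R) ->
    forall l : R, 0 < l -> g (l * x) / g x @[x --> +oo] --> l `^ b.
  by move=> gp fg; apply: rv_asymp_equiv fg frv => //; exact: nearW.
have [bE|bn0] := eqVneq b 0.
  have [fi fy] := f0 bE.
  have [g [gm gp fg]] := asymp_increasing_equiv fi.
  exists g; split => //; last exact: gy.
  apply/cvgryPge => A.
  have fA : \forall x \near +oo, 2 * A <= f x by move/cvgryPge : fy; exact.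
  have fg2 : \forall x \near +oo, f x / g x < 2 by apply: cvgr_lt fg _ _; lra.
  near=> x.
  have H1 : 2 * A <= f x by near: x.
  have : f x / g x < 2 by near: x.
  rewrite ltr_pdivrMr//; lra.
have b_gt0 : 0 < b by rewrite lt_neqAle eq_sym bn0.
have [g [gm gp fg]] := almost_increasing_equiv fp (rv_almost_increasing b_gt0 fc fp frv).
exists g; split => //; last exact: gy.
(* For [b > 0] divergence follows from the doubling ratio [2^b > 1]; for [b = 0] it was inherited
   from [f]. *)
apply: (@mono_ratio_cvgy _ 2 (2 `^ b)) => //; first exact: nearW.
  have := @gt0_ltr_powR R b b_gt0 1 2; rewrite powR1; apply; rewrite ?nnegrE; lra.
exact: gy.
Unshelve. all: by end_near. Qed.

(** * The function F *)

Lemma integrable_inv_itv (R : realType) (f : R -> R) (a b : R) :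
  {in `]0, +oo[, continuous f} -> (forall u : R, 0 < u -> 0 < f u) -> 0 < a ->
  lebesgue_measure.-integrable `[a, b] (EFin \o (fun u => (f u)^-1)).
Proof.
move=> fc fp a0; apply: continuous_compact_integrable; first exact: segment_compact.
apply: continuous_in_subspaceT => u; rewrite inE/= in_itv/= => /andP[au _].
have u0 : 0 < u by exact: lt_le_trans au.
apply: continuousV; first by rewrite gt_eqF ?fp.
by apply: fc; rewrite in_itv/= u0.
Qed.

Lemma Rintegral_itv_cst (R : realType) (a b c : R) : a <= b ->
  \int[lebesgue_measure]_(_ in `[a, b]) c = c * (b - a).
Proof.
move=> ab; rewrite Rintegral_cst//= lebesgue_measure_itv/= lte_fin.
by move: ab; rewrite le_eqVlt => /predU1P[->|->//]; rewrite ltxx subrr.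
Qed.

Lemma integrable_itv_cst (R : realType) (a b c : R) :
  lebesgue_measure.-integrable `[a, b] (EFin \o (fun=> c)).
Proof.
apply: continuous_compact_integrable; first exact: segment_compact.
by apply: continuous_subspaceT => x; exact: cvg_cst.
Qed.

Section Fint.
Variables (R : realType) (f : R -> R).
Hypothesis fc : {in `]0, +oo[, continuous f}.
Hypothesis fp : forall u : R, 0 < u -> 0 < f u.

Lemma Fint_ge1 x : 1 <= x -> Fint f x = \int[lebesgue_measure]_(u in `[1, x]) (f u)^-1.
Proof. by rewrite /Fint => ->. Qed.

Lemma Fint1 : Fint f 1 = 0.
Proof. by rewrite Fint_ge1// set_itv1 Rintegral_set1. Qed.

Lemma Fint_diff x y : 1 <= x -> x <= y ->
  Fint f y - Fint f x = \int[lebesgue_measure]_(u in `[x, y]) (f u)^-1.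
Proof.
move=> x1 xy; rewrite !Fint_ge1//; last exact: le_trans xy.
rewrite Rintegral_itvB ?bnd_simp//; last exact: integrable_inv_itv.
rewrite Rintegral_itv_obnd_cbnd//.
have x0 : 0 < x by exact: lt_le_trans x1.
by apply: integrableS (integrable_inv_itv y fc fp x0) => //; exact: subset_itv_oc_cc.
Qed.

Lemma integral_inv_ge m x y : 0 < x -> x <= y ->
  (forall u, x <= u <= y -> m <= (f u)^-1) ->
  m * (y - x) <= \int[lebesgue_measure]_(u in `[x, y]) (f u)^-1.
Proof.
move=> x0 xy mf; rewrite -Rintegral_itv_cst//; apply: le_Rintegral => //.
- exact: integrable_itv_cst.
- exact: integrable_inv_itv.
Qed.

Lemma integral_inv_le m x y : 0 < x -> x <= y ->
  (forall u, x <= u <= y -> (f u)^-1 <= m) ->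
  \int[lebesgue_measure]_(u in `[x, y]) (f u)^-1 <= m * (y - x).
Proof.
move=> x0 xy mf; rewrite -Rintegral_itv_cst//; apply: le_Rintegral => //.
- exact: integrable_inv_itv.
- exact: integrable_itv_cst.
Qed.

Lemma integral_inv_gt0 x y : 0 < x -> x < y ->
  0 < \int[lebesgue_measure]_(u in `[x, y]) (f u)^-1.
Proof.
move=> x0 xy.
have [|c] := @EVT_max R f x y (ltW xy).
  apply: continuous_in_subspaceT => u; rewrite inE/= in_itv/= => /andP[xu _].
  by apply: fc; rewrite in_itv/= andbT (lt_le_trans x0).
rewrite in_itv/= => /andP[xc _] fcm.
have c0 : 0 < c by exact: lt_le_trans xc.
apply: (@lt_le_trans _ _ ((f c)^-1 * (y - x))).
  by rewrite mulr_gt0 ?subr_gt0// invr_gt0 fp.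
apply: integral_inv_ge => //; first exact: ltW.
move=> u /andP[xu uy]; have u0 : 0 < u by exact: lt_le_trans xu.
by rewrite lef_pV2 ?posrE ?fp//; apply: fcm; rewrite in_itv/= xu.
Qed.

Lemma Fint_lt1 x : 0 < x -> x < 1 -> Fint f x < 0.
Proof.
move=> x0 x1; rewrite /Fint leNgt x1/= oppr_lt0; exact: integral_inv_gt0.
Qed.

Lemma Fint_lt x y : 1 <= x -> x < y -> Fint f x < Fint f y.
Proof.
move=> x1 xy; rewrite -subr_gt0 Fint_diff//; last exact: ltW.
by apply: integral_inv_gt0 => //; exact: lt_le_trans x1.
Qed.

Lemma Fint_le x y : 1 <= x -> x <= y -> Fint f x <= Fint f y.
Proof.
by move=> x1; rewrite le_eqVlt => /predU1P[->//|/(Fint_lt x1)/ltW].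
Qed.

Lemma Fint_gt0 x : 1 < x -> 0 < Fint f x.
Proof. by move=> x1; rewrite -Fint1 Fint_lt. Qed.

Lemma Fint_is_derive (x : R) : 1 < x -> is_derive x 1 (Fint f) (f x)^-1.
Proof.
move=> x1; have x0 : 0 < x by lra.
have xx1 : x < x + 1 by lra.
have int : lebesgue_measure.-integrable `[1, x + 1] (EFin \o (fun u => (f u)^-1)).
  exact: integrable_inv_itv.
have fVc : {for x, continuous (fun u => (f u)^-1)}.
  apply: continuousV; first by rewrite gt_eqF ?fp.
  by apply: fc; rewrite in_itv/= x0.
have [d dE] := continuous_FTC1_closed xx1 int x1 fVc.
have nE : \forall y \near x,
    \int[lebesgue_measure]_(t in `[1, y]) (f t)^-1 = Fint f y.
  near=> y; rewrite Fint_ge1//; apply/ltW; near: y; exact: lt_nbhsr.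
have d' : derivable (Fint f) x 1 by apply: near_eq_derivable d.
by split => //; rewrite -dE derive1E; apply/esym/near_eq_derive.
Unshelve. all: by end_near. Qed.

Lemma Fint_surj v : (exists2 x, 1 <= x & v <= Fint f x) -> 0 <= v ->
  exists2 x, 1 <= x & Fint f x = v.
Proof.
move=> [b b1 vb] v0.
have int : lebesgue_measure.-integrable `[1, b] (EFin \o (fun u => (f u)^-1)).
  exact: integrable_inv_itv.
have := @IVT R _ 1 b v b1 (parameterized_integral_continuous b1 int).
rewrite /parameterized_integral set_itv1 Rintegral_set1 -!Fint_ge1//.
case; first by rewrite ge_min le_max v0 vb orbT.
move=> c; rewrite in_itv/= => /andP[c1 _] <-; exists c => //.
by rewrite Fint_ge1.
Qed.

(* [s = 1] and [s = -1] give the two directions of the inequality. *)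
Lemma Fint_scale_compare (s l c : R) : 0 < l ->
  (\forall x \near +oo, 0 <= s * (c / f x - l / f (l * x))) ->
  exists X : R, [/\ 1 <= X, 1 <= l * X & forall x y : R, X <= x -> x <= y ->
    0 <= s * (c * (Fint f y - Fint f x) - (Fint f (l * y) - Fint f (l * x)))].
Proof.
move=> l0 [X0 [_ HX0]].
(* The term [2 + 2 / l] puts both [z] and [l * z] beyond 1, where the derivative of [F] is
   available. *)
pose X := Num.max (X0 + 1) (2 + 2 / l).
have il0 : 0 < l^-1 by rewrite invr_gt0.
have X1 : X0 + 1 <= X by rewrite le_max lexx.
have X2 : 2 + 2 / l <= X by rewrite le_max lexx orbT.
have X3 z : X <= z -> 1 < l * z.
  move=> Xz; apply: (@lt_le_trans _ _ (l * (2 + 2 / l))).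
    rewrite mulrDr mulrCA divff ?gt_eqF//; lra.
  by rewrite ler_pM2l// (le_trans X2).
exists X; split; [lra|exact/ltW/X3|move=> x y Xx xy].
(* The hypothesis says exactly that the derivative of [D] is nonnegative from [X] on. *)
pose D z := s * (c * Fint f z - Fint f (l * z)).
have Dd z : X <= z -> is_derive z 1 D (s * (c * (f z)^-1 - l * (f (l * z))^-1)).
  move=> Xz; apply: is_deriveZ; apply: is_deriveB.
    have F1 : is_derive z 1 (Fint f) (f z)^-1 by apply: Fint_is_derive; lra.
    exact: is_deriveZ.
  have F2 : is_derive (l * z) 1 (Fint f) (f (l * z))^-1.
    by apply: Fint_is_derive; exact: X3.
  have F3 : is_derive z 1 ( *%R l) l.
    by apply: is_derive_eq; rewrite scaler1.
  by rewrite mulrC; exact: is_derive1_comp.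
have Dd' z : X <= z -> derivable D z 1 by move/Dd => [].
suff : D x <= D y by rewrite /D; lra.
apply: (@ger0_derive1_ndecr _ D x y) => //.
- by move=> z; rewrite in_itv/= => /andP[xz _]; apply: Dd'; lra.
- move=> z; rewrite in_itv/= => /andP[xz _].
  have Xz : X <= z by lra.
  have [_ DE] := Dd z Xz.
  by rewrite derive1E DE; apply: HX0; lra.
- apply: derivable_within_continuous => z; rewrite in_itv/= => /andP[xz _].
  by apply: Dd'; lra.
Qed.

End Fint.

Section Fint_rv.
Variables (R : realType) (f : R -> R) (b : R).
Hypothesis fc : {in `]0, +oo[, continuous f}.
Hypothesis fp : forall u : R, 0 < u -> 0 < f u.
Hypothesis b1 : b < 1.
Hypothesis frv : forall l : R, 0 < l -> f (l * x) / f x @[x --> +oo] --> l `^ b.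

(** The quotient of the derivatives of [Fint f (l * x)] and [Fint f x], as in l'Hopital's rule. *)
Lemma inv_rv l : 0 < l ->
  l / f (l * x) * f x @[x --> +oo] --> l `^ (1 - b).
Proof.
move=> l0; have lb0 : 0 < l `^ b by exact: powR_gt0.
have -> : l `^ (1 - b) = l * (l `^ b)^-1.
  by rewrite powRB ?gt_eqF ?implybT// powRr1// ltW.
have H : l * (f (l * x) / f x)^-1 @[x --> +oo] --> l * (l `^ b)^-1.
  by apply: cvgMr; apply: cvgV; [rewrite gt_eqF|exact: frv].
apply: cvg_trans H; apply: near_eq_cvg; near=> x.
have x0 : 0 < x by near: x; apply: nbhs_pinfty_gt; rewrite num_real.
have f1 := fp x0.
have f2 : 0 < f (l * x) by apply: fp; exact: mulr_gt0.
by field; rewrite !gt_eqF.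
Unshelve. all: by end_near. Qed.

(** Choose [r] strictly between 1 and [2^(1 - b)]; doubling the arguments stretches increments of
    [F] by at least [r]. If [F] had a finite supremum [S], then [r * (S - F X) <= S - F (2 * X) <= S
    - F X], although [F X < S]. *)
Lemma Fint_cvgy : Fint f x @[x --> +oo] --> +oo.
Proof.
apply/cvgryPge => A; apply: contrapT => nA.
have FA x : 1 <= x -> Fint f x <= A.
  move=> x1; rewrite leNgt; apply/negP => Ax; apply: nA; near=> y.
  by apply: (le_trans (ltW Ax)); apply: Fint_le.
have l2 : (1 : R) < 2 `^ (1 - b).
  have b1' : 0 < 1 - b by rewrite subr_gt0.
  have := @gt0_ltr_powR R (1 - b) b1' 1 2; rewrite powR1; apply; rewrite ?nnegrE; lra.
pose r : R := (1 + 2 `^ (1 - b)) / 2.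
have r1 : 1 < r by rewrite /r; lra.
have [X [X1 _ HX]] : exists X : R, [/\ 1 <= X, 1 <= 2 * X & forall x y : R, X <= x -> x <= y ->
    0 <= -1 * (r * (Fint f y - Fint f x) - (Fint f (2 * y) - Fint f (2 * x)))].
  apply: Fint_scale_compare => //.
  have r2 : r < 2 `^ (1 - b) by rewrite /r; lra.
  have H : \forall x \near +oo, r < 2 / f (2 * x) * f x.
    by apply: cvgr_gt r2; apply: inv_rv.
  near=> x.
  have x0 : 0 < x by near: x; apply: nbhs_pinfty_gt; rewrite num_real.
  have f1 := fp x0.
  rewrite mulN1r opprB subr_ge0 ler_pdivrMr//; apply/ltW.
  by near: x.
pose E := Fint f @` [set x | X <= x].
have EA : has_ubound E.
  by exists A => _ [x /= Xx <-]; apply: FA; exact: le_trans Xx.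
pose S := sup E.
have SX x : X <= x -> Fint f x <= S by move=> Xx; apply: ub_le_sup => //; exists x.
have S1 : Fint f X < S.
  apply: (@lt_le_trans _ _ (Fint f (X + 1))); last by apply: SX; lra.
  by apply: Fint_lt => //; lra.
have S2 : S <= Fint f X + (S - Fint f (2 * X)) / r.
  apply: ge_sup; first by exists (Fint f X), X => /=.
  move=> _ [y /= Xy <-].
  rewrite -lerBlDl ler_pdivlMr; last lra.
  have h1 := HX X y (lexx _) Xy.
  have h2 : Fint f (2 * y) <= S by apply: SX; lra.
  by rewrite mulrC; lra.
have S3 : Fint f X <= Fint f (2 * X) by apply: Fint_le => //; lra.
have S4 : (S - Fint f X) * r <= S - Fint f (2 * X).
  by rewrite -ler_pdivlMr; lra.
have : (S - Fint f X) * 1 < (S - Fint f X) * r by rewrite ltr_pM2l; lra.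
lra.
Unshelve. all: by end_near. Qed.

Lemma Fint_rv l : 0 < l -> Fint f (l * x) / Fint f x @[x --> +oo] --> l `^ (1 - b).
Proof.
move=> l0.
have Fy A : \forall x \near +oo, A <= Fint f x by move: A; apply/cvgryPge; exact: Fint_cvgy.
(* [s] is both sign and slack: replacing the slope [c] by [c + s] gains [s ^+ 2 * Fint f x], which
   eventually exceeds the boundary term [K] left over at [X] because [F] diverges. *)
have compare s c X (m := c + s) : [/\ 1 <= X, 1 <= l * X & forall x y : R, X <= x -> x <= y ->
    0 <= s * (c * (Fint f y - Fint f x) - (Fint f (l * y) - Fint f (l * x)))] ->
   s != 0 -> \forall x \near +oo, 0 <= s * (m * Fint f x - Fint f (l * x)).
  move=> [X1 lX1 HX] s0.
  pose K := s * (Fint f (l * X) - c * Fint f X).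
  near=> x.
  have Xx : X <= x by near: x; apply: nbhs_pinfty_ge; rewrite num_real.
  have H2 := HX X x (lexx _) Xx.
  have H1 : K / s ^+ 2 <= Fint f x by near: x.
  have s2 : 0 < s ^+ 2 by rewrite exprn_even_gt0.
  move: H1; rewrite ler_pdivrMr// /K => H1.
  rewrite /m; rewrite -subr_ge0 in H1.
  have := addr_ge0 H1 H2; congr (0 <= _); ring.
apply: cvg_pinfty_between => m ml.
- pose d := (l `^ (1 - b) - m) / 2.
  have d0 : 0 < d by rewrite /d; lra.
  have H : \forall x \near +oo, m + d < l / f (l * x) * f x.
    by apply: (cvgr_gt _ (inv_rv l0)); rewrite /d; lra.
  have [X HX] : exists X : R, [/\ 1 <= X, 1 <= l * X & forall x y : R, X <= x -> x <= y ->
    0 <= - d * ((m + d) * (Fint f y - Fint f x) - (Fint f (l * y) - Fint f (l * x)))].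
    apply: Fint_scale_compare => //; near=> x.
    have x0 : 0 < x by near: x; apply: nbhs_pinfty_gt; rewrite num_real.
    have f1 := fp x0.
    rewrite mulNr -mulrN opprB mulr_ge0 ?(ltW d0)// subr_ge0 ler_pdivrMr//.
    by apply/ltW; near: x.
  have dn0 : - d != 0 by rewrite oppr_eq0 gt_eqF.
  have H2 := compare _ _ _ HX dn0.
  near=> x.
  have F0 : 1 <= Fint f x by near: x.
  rewrite ler_pdivlMr; last lra.
  have : 0 <= - d * ((m + d - d) * Fint f x - Fint f (l * x)) by near: x.
  by rewrite mulNr -mulrN pmulr_rge0// opprB subr_ge0 addrK.
- pose d := (m - l `^ (1 - b)) / 2.
  have d0 : 0 < d by rewrite /d; lra.
  have H : \forall x \near +oo, l / f (l * x) * f x < m - d.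
    by apply: (cvgr_lt _ (inv_rv l0)); rewrite /d; lra.
  have [X HX] : exists X : R, [/\ 1 <= X, 1 <= l * X & forall x y : R, X <= x -> x <= y ->
    0 <= d * ((m - d) * (Fint f y - Fint f x) - (Fint f (l * y) - Fint f (l * x)))].
    apply: Fint_scale_compare => //; near=> x.
    have x0 : 0 < x by near: x; apply: nbhs_pinfty_gt; rewrite num_real.
    have f1 := fp x0.
    rewrite mulr_ge0 ?(ltW d0)// subr_ge0 ler_pdivlMr//.
    by apply/ltW; near: x.
  have dn0 : d != 0 by rewrite gt_eqF.
  have H2 := compare _ _ _ HX dn0.
  near=> x.
  have F0 : 1 <= Fint f x by near: x.
  rewrite ler_pdivrMr; last lra.
  have : 0 <= d * ((m - d + d) * Fint f x - Fint f (l * x)) by near: x.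
  by rewrite pmulr_rge0// subr_ge0 subrK.
Unshelve. all: by end_near. Qed.

End Fint_rv.

(** * Karamata's theorem and the inverse of [F] *)

Lemma powR_slope (R : realType) (k : R) :
  ((1 + h) `^ k - 1) / h @[h --> (0 : R)^'] --> k.
Proof.
have [d dE] := @is_derive1_powR R k 1 ltr01.
move: dE; rewrite powR1 mulr1 => dE.
rewrite -[X in _ --> X]dE.
apply: cvg_trans d; apply: near_eq_cvg; near=> h => /=.
by rewrite powR1 [in RHS]mulrC (addrC _ 1) /GRing.scale/= mulr1.
Unshelve. all: by end_near. Qed.

Lemma powR_slope_gt (R : realType) (k m : R) : m < k ->
  exists l, 1 < l /\ m * (l - 1) < l `^ k - 1.
Proof.
move=> mk.
have H : \forall h \near (0 : R)^', m < ((1 + h) `^ k - 1) / h.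
  exact: (cvgr_gt _ (@powR_slope R k) _ mk).
have H' : \forall h \near (0 : R)^'+, m < ((1 + h) `^ k - 1) / h.
  move: H; rewrite !near_withinE; apply: filterS => h Ph h0.
  by apply: Ph; rewrite gt_eqF.
near ((0 : R)^'+) => h; exists (1 + h).
have h0 : 0 < h by near: h; exact: nbhs_right_gt.
split; first lra.
by rewrite addrAC subrr add0r -ltr_pdivlMr//; near: h.
Unshelve. all: by end_near. Qed.

Lemma powR_slope_lt (R : realType) (k m : R) : k < m ->
  exists l, [/\ 0 < l, l < 1 & 1 - l `^ k < m * (1 - l)].
Proof.
move=> mk.
have H : \forall h \near (0 : R)^', ((1 + h) `^ k - 1) / h < m.
  exact: (cvgr_lt _ (@powR_slope R k) _ mk).
have H' : \forall h \near (0 : R)^'-, ((1 + h) `^ k - 1) / h < m.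
  move: H; rewrite !near_withinE; apply: filterS => h Ph h0.
  by apply: Ph; rewrite lt_eqF.
near ((0 : R)^'-) => h; exists (1 + h).
have h0 : h < 0 by near: h; exact: nbhs_left_lt.
have h1 : -1 < h by near: h; apply: nbhs_left_gt; lra.
split; [lra|lra|].
have : ((1 + h) `^ k - 1) / h < m by near: h.
rewrite ltr_ndivrMr//; lra.
Unshelve. all: by end_near. Qed.

(** For fixed [l] near 1 the increment of [F] between [x] and [l * x] is about
    [(l^(1 - b) - 1) * F x] by regular variation. Monotonicity of [g] compares it with
    [(l * x - x) / g x]: from above if [l > 1], from below if [l < 1]. The slope of the power at 1
    produces [1 - b]. *)
Lemma karamata (R : realType) (b : R) (f g : R -> R) : b < 1 ->
  {in `]0, +oo[, continuous f} -> (forall u : R, 0 < u -> 0 < f u) ->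
  (forall l : R, 0 < l -> f (l * x) / f x @[x --> +oo] --> l `^ b) ->
  {homo g : x y / x <= y} -> (forall x, 0 < g x) ->
  f x / g x @[x --> +oo] --> (1 : R) ->
  x / (g x * Fint f x) @[x --> +oo] --> 1 - b.
Proof.
move=> b1 fc fp frv gm gp fg.
have k0 : 0 < 1 - b by rewrite subr_gt0.
have F1 : \forall x \near +oo, 1 <= Fint f x.
  by have /cvgryPge := Fint_cvgy fc fp b1 frv; exact.
apply: cvg_pinfty_between => m mk.
- have [m0|m0] := leP m 0.
    near=> x; apply: (le_trans m0); apply: divr_ge0.
      by near: x; apply: nbhs_pinfty_ge; rewrite num_real.
    apply: mulr_ge0; first exact: ltW.
    by apply: (@le_trans _ _ 1) => //; near: x.
  (* The gap is shared: [m' < 1 - b] is spent on the slope at [l], and [m / m' < 1] on the error in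
     the equivalence of [f] and [g]. *)
  pose m' := (m + (1 - b)) / 2.
  have m'k : m' < 1 - b by rewrite /m'; lra.
  have mm' : m < m' by rewrite /m'; lra.
  have [l [l1 ml]] := powR_slope_gt m'k.
  have l0 : 0 < l by lra.
  have m'0 : 0 < m' by lra.
  have r1 : m / m' < 1 by rewrite ltr_pdivrMr// mul1r.
  have [X [_ HX]] : \forall x \near +oo, m / m' < f x / g x.
    exact: (cvgr_gt _ fg).
  have Fl : \forall x \near +oo, 1 + m' * (l - 1) < Fint f (l * x) / Fint f x.
    by apply: (cvgr_gt _ (Fint_rv fc fp b1 frv l0)); lra.
  near=> x.
  have x1 : 1 <= x by near: x; apply: nbhs_pinfty_ge; rewrite num_real.
  have xX : X < x by near: x; apply: nbhs_pinfty_gt; rewrite num_real.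
  have Fx : 1 <= Fint f x by near: x.
  have x0 : 0 < x by lra.
  have xlx : x <= l * x by rewrite ler_peMl//; lra.
  have h1 : 1 + m' * (l - 1) < Fint f (l * x) / Fint f x by near: x.
  have F0 : 0 < Fint f x by lra.
  rewrite ltr_pdivlMr// in h1.
  have h2 : Fint f (l * x) - Fint f x <= m' / m / g x * (l * x - x).
    rewrite Fint_diff//; apply: integral_inv_le => // u /andP[xu _].
    have u0 : 0 < u by lra.
    have fu := fp _ u0.
    have h3 : m / m' < f u / g u by apply: HX; lra.
    rewrite ltr_pdivlMr// mulrAC ltr_pdivrMr// in h3.
    rewrite -[(f u)^-1]mul1r ler_pdivrMr//.
    have -> : m' / m / g x * f u = m' * f u / (m * g x).
      by field; rewrite !gt_eqF.
    rewrite ler_pdivlMr ?mulr_gt0// mul1r [leRHS]mulrC.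
    apply: le_trans (ltW h3); rewrite ler_pM2l//; exact: gm.
  have l10 : 0 < l - 1 by lra.
  rewrite ler_pdivlMr ?mulr_gt0// -(ler_pM2l m'0) -(ler_pM2l l10).
  have -> : (l - 1) * (m' * x) = (m' / m / g x * (l * x - x)) * (m * g x).
    by field; rewrite !gt_eqF.
  have -> : (l - 1) * (m' * (m * (g x * Fint f x))) =
      m' * (l - 1) * Fint f x * (m * g x) by ring.
  rewrite ler_pM2r ?mulr_gt0//; lra.
- pose m' := (m + (1 - b)) / 2.
  have m'k : 1 - b < m' by rewrite /m'; lra.
  have mm' : m' < m by rewrite /m'; lra.
  have [l [l0 l1 ml]] := powR_slope_lt m'k.
  have m'0 : 0 < m' by lra.
  have m0 : 0 < m by lra.
  have r1 : 1 < m / m' by rewrite ltr_pdivlMr// mul1r.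
  have [X [_ HX]] : \forall x \near +oo, f x / g x < m / m'.
    exact: (cvgr_lt _ fg).
  have Fl : \forall x \near +oo, 1 - m' * (1 - l) < Fint f (l * x) / Fint f x.
    by apply: (cvgr_gt _ (Fint_rv fc fp b1 frv l0)); lra.
  near=> x.
  have x1 : 1 / l <= x by near: x; apply: nbhs_pinfty_ge; rewrite num_real.
  have xX : X / l < x by near: x; apply: nbhs_pinfty_gt; rewrite num_real.
  rewrite ler_pdivrMr// mulrC in x1; rewrite ltr_pdivrMr// mulrC in xX.
  have Fx : 1 <= Fint f x by near: x.
  have F0 : 0 < Fint f x by lra.
  have x0 : 0 < x by rewrite -(pmulr_rgt0 _ l0); lra.
  have xlx : l * x <= x by rewrite ger_pMl// ltW.
  have h1 : 1 - m' * (1 - l) < Fint f (l * x) / Fint f x by near: x.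
  rewrite ltr_pdivlMr// in h1.
  have h2 : m' / m / g x * (x - l * x) <= Fint f x - Fint f (l * x).
    rewrite Fint_diff//; apply: integral_inv_ge => //; first lra.
    move=> u /andP[xu ux].
    have u0 : 0 < u by lra.
    have fu := fp _ u0.
    have h3 : f u / g u < m / m' by apply: HX; lra.
    rewrite ltr_pdivrMr// mulrAC ltr_pdivlMr// in h3.
    rewrite -[(f u)^-1]mul1r ler_pdivlMr//.
    have -> : m' / m / g x * f u = m' * f u / (m * g x).
      by field; rewrite !gt_eqF.
    rewrite ler_pdivrMr ?mulr_gt0// mul1r [leLHS]mulrC.
    apply: (le_trans (ltW h3)); rewrite ler_pM2l//; exact: gm.
  have l10 : 0 < 1 - l by lra.
  rewrite ler_pdivrMr ?mulr_gt0// -(ler_pM2l m'0) -(ler_pM2l l10).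
  have -> : (1 - l) * (m' * x) = (m' / m / g x * (x - l * x)) * (m * g x).
    by field; rewrite !gt_eqF.
  have -> : (1 - l) * (m' * (m * (g x * Fint f x))) =
      m' * (1 - l) * Fint f x * (m * g x) by ring.
  rewrite ler_pM2r ?mulr_gt0//; lra.
Unshelve. all: by end_near. Qed.

(** [F] is negative to the left of 1, so a preimage of [v >= 0] must lie in [[1, oo)], whatever
    [1 / f] does near 0. Divergence of [F] puts [v] in its range, so the default value of the
    pseudo-inverse does not occur. *)
Lemma FinvK (R : realType) (b : R) (f : R -> R) (v : R) : b < 1 ->
  {in `]0, +oo[, continuous f} -> (forall u : R, 0 < u -> 0 < f u) ->
  (forall l : R, 0 < l -> f (l * x) / f x @[x --> +oo] --> l `^ b) -> 0 <= v ->
  1 <= Finv f v /\ Fint f (Finv f v) = v.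
Proof.
move=> b1 fc fp frv v0.
have [x x1 xv] : exists2 x, 1 <= x & Fint f x = v.
  apply: Fint_surj => //; near (pinfty_nbhs R) => x; exists x.
    by near: x; apply: nbhs_pinfty_ge; rewrite num_real.
  by near: x; have /cvgryPge := Fint_cvgy fc fp b1 frv; exact.
have surj : set_surj `]0, +oo[ [set v] (Fint f).
  by move=> _ ->; exists x => //=; rewrite in_itv/= andbT; lra.
have Fv : Fint f (Finv f v) = v by apply: (surjpK _ surj); rewrite inE.
split=> //; rewrite leNgt; apply/negP => lt1.
have /= := @surjpinv_image_sub _ _ (fun=> 0) _ _ _ surj (Finv f v).
case/(_ (ex_intro2 _ _ v erefl erefl))/andP => gt0 _.
by have := Fint_lt1 fc fp gt0 lt1; rewrite Fv ltNge v0.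
Unshelve. all: by end_near. Qed.

(** * Convolutions of monotone functions *)

Lemma bounded_integrable_itv (R : realType) (a b C : R) (g : R -> R) :
  measurable_fun `[a, b] g -> (forall x, a <= x <= b -> `|g x| <= C) ->
  lebesgue_measure.-integrable `[a, b] (EFin \o g).
Proof.
move=> mg gC; apply: measurable_bounded_integrable => //.
  rewrite /= lebesgue_measure_itv/=; case: ifP => // _; exact: ltry.
exists C; split; first exact: num_real.
by move=> B CB x /= xab; apply: le_trans (ltW CB); apply: gC.
Qed.

Lemma Rintegral_itv_split (R : realType) (a b c : R) (g : R -> R) :
  lebesgue_measure.-integrable `[a, b] (EFin \o g) -> a <= c -> c <= b ->
  \int[lebesgue_measure]_(x in `[a, b]) g x =
  \int[lebesgue_measure]_(x in `[a, c]) g x +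
  \int[lebesgue_measure]_(x in `[c, b]) g x.
Proof.
move=> gi ac cb; apply/eqP; rewrite addrC -subr_eq; apply/eqP.
rewrite Rintegral_itvB ?bnd_simp// Rintegral_itv_obnd_cbnd//.
by apply: integrableS gi => //; apply: subset_itvr; rewrite bnd_simp.
Qed.

Section mono_product.
Variables (R : realType) (P Q : R -> R).
Hypotheses (Pm : {homo P : x y /~ x <= y}) (Qm : {homo Q : x y / x <= y}).
Hypotheses (P0 : forall x, 0 <= P x) (Q0 : forall x, 0 <= Q x).

Lemma mono_product_integrable a b :
  lebesgue_measure.-integrable `[a, b] (EFin \o (fun x => P x * Q x)).
Proof.
apply: (@bounded_integrable_itv _ _ _ (P a * Q b)).
  apply: measurable_funM; first by apply: nonincreasing_measurable => // x y xy; exact: Pm.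
  exact: nondecreasing_measurable.
move=> x /andP[ax xb]; rewrite ger0_norm ?mulr_ge0//.
by apply: ler_pM => //; [exact: Pm|exact: Qm].
Qed.

(** With [P] nonincreasing and [Q] nondecreasing, the product on a cell is bounded by products of
    values at opposite ends, without any continuity. *)
Lemma mono_product_sums (d : R) (n : nat) : 0 <= d ->
  d * (\sum_(i < n) P (i.+1%:R * d) * Q (i%:R * d)) <=
    \int[lebesgue_measure]_(x in `[0, n%:R * d]) (P x * Q x) <=
  d * (\sum_(i < n) P (i%:R * d) * Q (i.+1%:R * d)).
Proof.
move=> d0; elim: n => [|n /andP[IH1 IH2]].
  by rewrite mul0r set_itv1 Rintegral_set1 !big_ord0 mulr0 lexx.
have nd : n%:R * d <= n.+1%:R * d by rewrite ler_wpM2r// ler_nat.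
have nd0 : 0 <= n%:R * d by rewrite mulr_ge0.
rewrite (@Rintegral_itv_split _ _ _ (n%:R * d))//; last exact: mono_product_integrable.
rewrite !big_ord_recr/= !mulrDr.
have dE : n.+1%:R * d - n%:R * d = d by rewrite -natr1; ring.
have cst c : d * c = \int[lebesgue_measure]_(_ in `[n%:R * d, n.+1%:R * d]) c.
  by rewrite Rintegral_itv_cst// dE mulrC.
apply/andP; split; apply: lerD => //.
- rewrite cst; apply: le_Rintegral => //.
  + exact: integrable_itv_cst.
  + exact: mono_product_integrable.
  + move=> x /=; rewrite in_itv/= => /andP[x1 x2].
    by apply: ler_pM => //; [exact: Pm|exact: Qm].
- rewrite cst; apply: le_Rintegral => //.
  + exact: mono_product_integrable.
  + exact: integrable_itv_cst.
  + move=> x /=; rewrite in_itv/= => /andP[x1 x2].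
    by apply: ler_pM => //; [exact: Pm|exact: Qm].
Qed.

End mono_product.

(** Each difference of terms is [p i * (q i.+1 - q i) + q i * (p i - p i.+1)], and the weights are
    at most 1, so the sum telescopes. The 2 bounds the two total variations. *)
Lemma mono_sums_close (R : realType) (p q : nat -> R) (n : nat) :
  (forall i, p i.+1 <= p i) -> (forall i, q i <= q i.+1) ->
  (forall i, (i <= n)%N -> 0 <= p i <= 1 /\ 0 <= q i <= 1) ->
  \sum_(i < n) p i * q i.+1 <= \sum_(i < n) p i.+1 * q i + 2.
Proof.
move=> pm qm pq.
suff H k : (k <= n)%N -> \sum_(i < k) p i * q i.+1 <=
    \sum_(i < k) p i.+1 * q i + (q k - q 0%N) + (p 0%N - p k).
  have := H n (leqnn n); have [] := pq n (leqnn n); have [] := pq 0%N (leq0n n).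
  lra.
elim: k => [|k IH] kn; first by rewrite !big_ord0; lra.
rewrite !big_ord_recr/=; have := IH (ltnW kn).
have [/andP[p0 p1] /andP[q0 q1]] := pq k (ltnW kn).
have h1 : 0 <= (1 - p k) * (q k.+1 - q k).
  by apply: mulr_ge0; have := qm k; lra.
have h2 : 0 <= (1 - q k) * (p k - p k.+1).
  by apply: mulr_ge0; have := pm k; lra.
rewrite !mulrBl !mulrBr !mul1r in h1 h2; rewrite (mulrC (q k)) (mulrC (q k)) in h2; lra.
Qed.

Section conv_limit.
Variables (R : realType) (M G m g : R -> R).
Hypotheses (Mm : {homo M : x y / x <= y}) (Gm : {homo G : x y / x <= y}).
Hypotheses (mm : {homo m : x y / x <= y}) (gm : {homo g : x y / x <= y}).
Hypotheses (M0 : forall x, 0 <= M x) (G0 : forall x, 0 <= G x).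
Hypotheses (m0 : forall x, 0 <= m x) (g0 : forall x, 0 <= g x).
Hypotheses (m1 : m 1 <= 1) (g1 : g 1 <= 1).
Hypotheses (Mp : \forall t \near +oo, 0 < M t) (Gp : \forall t \near +oo, 0 < G t).
Hypothesis Ml : forall r, 0 <= r <= 1 -> M (t * r) / M t @[t --> +oo] --> m r.
Hypothesis Gl : forall r, 0 <= r <= 1 -> G (t * r) / G t @[t --> +oo] --> g r.

Let upper n := n.+1%:R^-1 *
  (\sum_(i < n.+1) m (1 - i%:R * n.+1%:R^-1) * g (i.+1%:R * n.+1%:R^-1)).
Let lower n := n.+1%:R^-1 *
  (\sum_(i < n.+1) m (1 - i.+1%:R * n.+1%:R^-1) * g (i%:R * n.+1%:R^-1)).

(** The reflection [u -> 1 - u] is carried out on the sums, by reversing the index, rather than on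
    the integral. *)
Lemma conv_limit_integral_bounds n : lower n <=
  \int[lebesgue_measure]_(u in `[0, 1]) (m u * g (1 - u)) <= upper n.
Proof.
have h0 : (0 : R) <= n.+1%:R^-1 by rewrite invr_ge0.
have n0 : (n.+1%:R : R) != 0 by rewrite pnatr_eq0.
have gm' : {homo (fun u => g (1 - u)) : x y /~ x <= y}.
  by move=> x y xy; apply: gm; rewrite lerD2l lerN2.
have := mono_product_sums gm' mm (fun=> g0 _) m0 n.+1 h0.
rewrite divff//; under eq_Rintegral do rewrite mulrC.
have E (i : 'I_n.+1) : (rev_ord i)%:R * (n.+1%:R : R)^-1 = 1 - i.+1%:R * n.+1%:R^-1.
  by rewrite /= natrB// mulrBl divff.
have E' (i : 'I_n.+1) : (rev_ord i).+1%:R * (n.+1%:R : R)^-1 = 1 - i%:R * n.+1%:R^-1.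
  by rewrite -natr1 mulrDl E -natr1; ring.
rewrite (reindex_inj rev_ord_inj) [X in _ && (_ <= _ * X)](reindex_inj rev_ord_inj).
under eq_bigr do rewrite E E' subKr mulrC.
under [X in _ && (_ <= _ * X)]eq_bigr do rewrite E E' subKr mulrC.
by [].
Qed.

Lemma conv_limit_sums_close n : upper n <= lower n + 2 / n.+1%:R.
Proof.
rewrite /upper /lower (mulrC 2) -mulrDr ler_pM2l ?invr_gt0//.
have n0 : (n.+1%:R : R) != 0 by rewrite pnatr_eq0.
have h0 : (0 : R) <= n.+1%:R^-1 by rewrite invr_ge0.
have S i : i%:R * (n.+1%:R : R)^-1 <= i.+1%:R * n.+1%:R^-1.
  by rewrite ler_wpM2r// ler_nat.
apply: (@mono_sums_close R (fun i => m (1 - i%:R * n.+1%:R^-1))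
  (fun i => g (i%:R * n.+1%:R^-1))).
- by move=> i; apply: mm; rewrite lerD2l lerN2.
- by move=> i; apply: gm.
move=> i ni; rewrite m0 g0/=.
have i0 : 0 <= i%:R * (n.+1%:R : R)^-1 by rewrite mulr_ge0.
have i1 : i%:R * (n.+1%:R : R)^-1 <= 1.
  by rewrite ler_pdivrMr// mul1r ler_nat.
split; first by apply: le_trans m1; apply: mm; rewrite gerBl.
by apply: le_trans g1; apply: gm.
Qed.

Let conv t := \int[lebesgue_measure]_(s in `[0, t]) (M (t - s) * G s).

Lemma conv_bounds t n : 0 <= t ->
  t / n.+1%:R * (\sum_(i < n.+1) M (t * (1 - i.+1%:R / n.+1%:R)) * G (t * (i%:R / n.+1%:R)))
  <= conv t <=
  t / n.+1%:R * (\sum_(i < n.+1) M (t * (1 - i%:R / n.+1%:R)) * G (t * (i.+1%:R / n.+1%:R))).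
Proof.
move=> t0; have n0 : (n.+1%:R : R) != 0 by rewrite pnatr_eq0.
have d0 : 0 <= t / n.+1%:R by rewrite divr_ge0.
have Mm' : {homo (fun u => M (t - u)) : x y /~ x <= y}.
  by move=> x y xy; apply: Mm; rewrite lerD2l lerN2.
have := mono_product_sums Mm' Gm (fun=> M0 _) G0 n.+1 d0.
have E i : i%:R * (t / n.+1%:R) = t * (i%:R / n.+1%:R) by ring.
have E' i : t - i%:R * (t / n.+1%:R) = t * (1 - i%:R / n.+1%:R) by ring.
have -> : n.+1%:R * (t / n.+1%:R) = t by rewrite mulrCA divff// mulr1.
under eq_bigr do rewrite E' E.
by under [X in _ && (_ <= _ * X)]eq_bigr do rewrite E' E.
Qed.

Let ratio_sum_cvg n (a b : nat -> R) :
  (forall i : 'I_n.+1, 0 <= a i <= 1 /\ 0 <= b i <= 1) ->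
  t / n.+1%:R * (\sum_(i < n.+1) M (t * a i) * G (t * b i)) / (t * M t * G t)
    @[t --> +oo] --> n.+1%:R^-1 * (\sum_(i < n.+1) m (a i) * g (b i)).
Proof.
move=> ab.
have H : n.+1%:R^-1 * (\sum_(i < n.+1) (M (t * a i) / M t) * (G (t * b i) / G t))
    @[t --> +oo] --> n.+1%:R^-1 * (\sum_(i < n.+1) m (a i) * g (b i)).
  apply: cvgMr; apply: cvg_big => [|i _]; first exact: add_continuous.
  by have [? ?] := ab i; apply: cvgM; [exact: Ml|exact: Gl].
apply: cvg_trans H; apply: near_eq_cvg; near=> t.
have t0 : 0 < t by near: t; apply: nbhs_pinfty_gt; rewrite num_real.
have Mt : 0 < M t by near: t.
have Gt : 0 < G t by near: t.
have n0 : (n.+1%:R : R) != 0 by rewrite pnatr_eq0.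
rewrite mulr_sumr !mulr_sumr mulr_suml; apply: eq_bigr => i _.
by field; rewrite nat1r n0 !gt_eqF.
Unshelve. all: by end_near. Qed.

(** For a fixed number of cells, the Riemann sums of the convolution converge term by term to
    [upper n] and [lower n]. These enclose the limit integral and differ by at most [2 / n.+1], so
    pointwise limits of the ratios suffice. [n] is chosen to make this error smaller than the gap to
    [c]. *)
Lemma conv_limit : conv t / (t * M t * G t) @[t --> +oo] -->
  \int[lebesgue_measure]_(u in `[0, 1]) (m u * g (1 - u)).
Proof.
have frac n (i : 'I_n.+1) : [/\ 0 <= i%:R / (n.+1%:R : R) <= 1,
    0 <= i.+1%:R / (n.+1%:R : R) <= 1, 0 <= 1 - i%:R / (n.+1%:R : R) <= 1 &
    0 <= 1 - i.+1%:R / (n.+1%:R : R) <= 1].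
  have h k : (k <= n.+1)%N -> 0 <= k%:R / (n.+1%:R : R) <= 1.
    by move=> kn; rewrite divr_ge0//= ler_pdivrMr// mul1r ler_nat.
  have h1 := h i (ltnW (ltn_ord i)); have h2 := h i.+1 (ltn_ord i).
  have h' (y : R) : 0 <= y <= 1 -> 0 <= 1 - y <= 1 by lra.
  by split => //; exact: h'.
have pos : \forall t \near +oo, 0 <= t /\ 0 < t * M t * G t.
  near=> t.
  have t0 : 0 < t by near: t; apply: nbhs_pinfty_gt; rewrite num_real.
  split; first exact: ltW.
  by rewrite !mulr_gt0//; near: t.
have small e : 0 < e -> exists n, 2 / (n.+1%:R : R) < e.
  move=> e0; exists (Num.truncn (2 / e)).
  by rewrite ltr_pdivrMr// mulrC -ltr_pdivrMr// truncnS_gt.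
apply: cvg_pinfty_between => c cB.
- have [|n hn] := small (\int[lebesgue_measure]_(u in `[0, 1]) (m u * g (1 - u)) - c).
    by rewrite subr_gt0.
  have /andP[_ h1] := conv_limit_integral_bounds n.
  have h2 := conv_limit_sums_close n.
  move: hn h1 h2; set e := 2 / _; set B := Rintegral _ _ _ => hn h1 h2.
  have h3 : c < lower n by lra.
  have lim := @ratio_sum_cvg n (fun i => 1 - i.+1%:R / n.+1%:R) (fun i => i%:R / n.+1%:R).
  have near_c : \forall t \near +oo, c < t / n.+1%:R *
      (\sum_(i < n.+1) M (t * (1 - i.+1%:R / n.+1%:R)) * G (t * (i%:R / n.+1%:R)))
      / (t * M t * G t).
    apply: (cvgr_gt _ (lim _)) => // i; by have [] := frac n i.
  near=> t.
  have [t0 tMG] : 0 <= t /\ 0 < t * M t * G t by near: t.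
  apply: le_trans (_ : _ <= t / n.+1%:R *
      (\sum_(i < n.+1) M (t * (1 - i.+1%:R / n.+1%:R)) * G (t * (i%:R / n.+1%:R)))
      / (t * M t * G t)) _.
    by apply/ltW; near: t.
  by rewrite ler_pM2r ?invr_gt0//; have /andP[] := conv_bounds n t0.
- have [|n hn] := small (c - \int[lebesgue_measure]_(u in `[0, 1]) (m u * g (1 - u))).
    by rewrite subr_gt0.
  have /andP[h1 _] := conv_limit_integral_bounds n.
  have h2 := conv_limit_sums_close n.
  move: hn h1 h2; set e := 2 / _; set B := Rintegral _ _ _ => hn h1 h2.
  have h3 : upper n < c by lra.
  have lim := @ratio_sum_cvg n (fun i => 1 - i%:R / n.+1%:R) (fun i => i.+1%:R / n.+1%:R).
  have near_c : \forall t \near +oo, t / n.+1%:R *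
      (\sum_(i < n.+1) M (t * (1 - i%:R / n.+1%:R)) * G (t * (i.+1%:R / n.+1%:R)))
      / (t * M t * G t) < c.
    apply: (cvgr_lt _ (lim _)) => // i; by have [] := frac n i.
  near=> t.
  have [t0 tMG] : 0 <= t /\ 0 < t * M t * G t by near: t.
  apply: le_trans (_ : t / n.+1%:R *
      (\sum_(i < n.+1) M (t * (1 - i%:R / n.+1%:R)) * G (t * (i.+1%:R / n.+1%:R)))
      / (t * M t * G t) <= _).
    by rewrite ler_pM2r ?invr_gt0//; have /andP[] := conv_bounds n t0.
  by apply/ltW; near: t.
Unshelve. all: by end_near. Qed.

End conv_limit.

(** * Time shifts of integrals and the Beta integral *)

Lemma lebesgue_measure_translate (R : realType) (c : R) (A : set R) :
  measurable A ->
  pushforward lebesgue_measure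
    (fun x : measurableTypeR R => x + c : measurableTypeR R) A =
  lebesgue_measure A.
Proof.
have mc : measurable_fun setT (fun x : measurableTypeR R => x + c : measurableTypeR R).
  by apply: measurable_funD => //; exact: measurable_cst.
move=> mA.
pose nu := pushforward (@lebesgue_measure R)
  (fun x : measurableTypeR R => x + c : measurableTypeR R).
apply/esym/(@lebesgue_measure_unique _ nu) => //= _ [[a b]] _ <-.
rewrite /nu /pushforward.
have -> : (fun x => x + c) @^-1` `]a, b]%classic = `]a - c, b - c]%classic.
  by apply/seteqP; split => x /=; rewrite !in_itv/= ltrBlDr lerBrDr.
rewrite !lebesgue_measure_itv/= !lte_fin ltrD2r; case: ifPn => // _.
by rewrite -!EFinB; congr EFin; ring.
Qed.

Lemma Rintegral_translate (R : realType) (a b c : R) (g : R -> R) :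
  measurable_fun setT g -> (forall x, 0 <= g x) ->
  \int[lebesgue_measure]_(x in `[a, b]) g (x + c) =
  \int[lebesgue_measure]_(x in `[a + c, b + c]) g x.
Proof.
move=> mg g0; rewrite /Rintegral; congr fine.
pose phi : measurableTypeR R -> measurableTypeR R := fun x => x + c.
have mc : measurable_fun setT phi.
  by apply: measurable_funD => //; exact: measurable_cst.
have -> : `[a, b]%classic = phi @^-1` `[a + c, b + c]%classic.
  by apply/seteqP; split => x /=; rewrite !in_itv/= !lerD2r.
transitivity (\int[pushforward lebesgue_measure phi]_(x in
    `[(a + c)%R, (b + c)%R]) (g x)%:E)%E.
  rewrite ge0_integral_pushforward//=.
  - by apply: measurableT_comp => //; exact: measurable_funS mg.
  - by move=> x _; rewrite lee_fin.
by apply: eq_measure_integral => A mA _; exact: lebesgue_measure_translate.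
Qed.

(* Unlike [powR], [powR_pos 0] vanishes at [0], as does [lim M (0 * t) / M t]. *)
Definition powR_pos (R : realType) (p r : R) := if 0 < r then r `^ p else 0.

Section powR_pos.
Variables (R : realType) (p : R).
Hypothesis p0 : 0 <= p.

Lemma powR_pos_mono : {homo @powR_pos R p : x y / x <= y}.
Proof.
move=> x y xy; rewrite /powR_pos; case: ifPn => x0; last first.
  by case: ifPn => // _; exact: powR_ge0.
rewrite (lt_le_trans x0 xy); apply: ge0_ler_powR => //; rewrite nnegrE ltW//.
exact: lt_le_trans xy.
Qed.

Lemma powR_pos_ge0 r : 0 <= powR_pos p r.
Proof. by rewrite /powR_pos; case: ifPn => // _; exact: powR_ge0. Qed.

Lemma powR_pos1 : powR_pos p 1 <= 1.
Proof. by rewrite /powR_pos ltr01 powR1. Qed.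

End powR_pos.

Section Beta_pos.
Variables (R : realType) (p q : R).
Hypotheses (p0 : 0 <= p) (q0 : 0 <= q).

(** The integrands agree on the open interval; the values at the end points, where [powR] and
    [powR_pos] may differ, do not affect the integral. *)
Lemma BetaE : Beta (1 + p) (1 + q) =
  \int[lebesgue_measure]_(u in `[0, 1]) (powR_pos p u * powR_pos q (1 - u)).
Proof.
rewrite /Beta.
have qm : {homo (fun u => powR_pos q (1 - u)) : x y /~ x <= y}.
  by move=> x y xy; apply: powR_pos_mono => //; rewrite lerD2l lerN2.
have E u : `]0, 1[%classic u ->
    powR_pos p u * powR_pos q (1 - u) = u `^ (1 + p - 1) * (1 - u) `^ (1 + q - 1).
  rewrite /= in_itv/= => /andP[u0 u1].
  have e r : 1 + r - 1 = r :> R by rewrite addrAC subrr add0r.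
  by rewrite /powR_pos u0 subr_gt0 u1 !e.
have L (g : R -> R) : measurable_fun setT g ->
    \int[lebesgue_measure]_(u in `[0 : R, 1]) g u =
    \int[lebesgue_measure]_(u in `]0, 1[) g u.
  move=> mg; rewrite /Rintegral; congr fine.
  rewrite integral_itv_bndoo//; apply/measurable_EFinP.
  by apply: (@measurable_funS _ _ _ _ setT).
have m1 : measurable_fun setT (fun u : R => 1 - u) by exact: measurable_funB.
rewrite !L; first by apply: eq_Rintegral => u; rewrite inE => u01; exact/esym/E.
- apply: measurable_funM; first by apply: nondecreasing_measurable => //; exact: powR_pos_mono.
  by apply: nonincreasing_measurable => // x y xy; exact: qm.
- apply: measurable_funM; first exact: measurable_powR.
  exact: (measurableT_comp (measurable_powR _) m1).
Qed.

Lemma Beta_gt0 : 0 < Beta (1 + p) (1 + q).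
Proof.
rewrite BetaE.
have qm : {homo (fun u => powR_pos q (1 - u)) : x y /~ x <= y}.
  by move=> x y xy; apply: powR_pos_mono => //; rewrite lerD2l lerN2.
have := mono_product_sums qm (powR_pos_mono p0) (fun=> powR_pos_ge0 _ _) (powR_pos_ge0 _) 3.
have d0 : 0 <= (3 : R)^-1 by rewrite invr_ge0.
move=> /(_ _ d0); rewrite divff//; under eq_Rintegral do rewrite mulrC.
move=> /andP[+ _]; apply: lt_le_trans.
rewrite mulr_gt0//.
(* Of the three cells only the middle one is needed: its term is [(1/3)^q * (1/3)^p > 0], and the
   outer terms are nonnegative. *)
rewrite !big_ord_recr big_ord0/= add0r.
apply: ltr_wpDr; first by rewrite mulr_ge0 ?powR_pos_ge0.
apply: ltr_wpDl; first by rewrite mulr_ge0 ?powR_pos_ge0.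
by rewrite /powR_pos mul1r !ifT ?mulr_gt0 ?powR_gt0//; lra.
Qed.

End Beta_pos.

Lemma cvg_div_cvgy (R : realType) (k : R) (v : R -> R) :
  v t @[t --> +oo] --> +oo -> k / v t @[t --> +oo] --> (0 : R).
Proof.
move=> vy; apply/cvgrPdist_le => e e0.
have H1 : \forall t \near +oo, `|k| / e <= v t by move/cvgryPge : vy; exact.
have H2 : \forall t \near +oo, 0 < v t by move/cvgryPgt : vy; exact.
near=> t.
have h1 : `|k| / e <= v t by near: t.
have h2 : 0 < v t by near: t.
rewrite sub0r normrN normrM normfV (gtr0_norm h2) ler_pdivrMr//.
by rewrite mulrC -ler_pdivrMr.
Unshelve. all: by end_near. Qed.

(** * The memory integral along multiples of [a] *)

Section convolution.
Variables (R : realType) (theta beta : R) (M phi a : R -> R).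
Hypotheses (theta0 : 0 <= theta) (beta0 : 0 <= beta) (beta1 : beta < 1).
Hypotheses (Mm : {homo M : x y / x <= y}) (M0 : forall t, 0 <= M t).
Hypothesis My : M t @[t --> +oo] --> +oo.
Hypothesis Mrv : forall l, 0 < l -> M (l * x) / M x @[x --> +oo] --> l `^ theta.
Hypotheses (phim : {homo phi : x y / x <= y}) (phi0 : forall t, 0 < phi t).
Hypothesis phiy : phi t @[t --> +oo] --> +oo.
Hypothesis phirv : forall l, 0 < l -> phi (l * x) / phi x @[x --> +oo] --> l `^ beta.
Hypotheses (am : {homo a : x y / x <= y}) (a0 : forall t, 0 < a t).
Hypothesis ay : a t @[t --> +oo] --> +oo.
Hypothesis arv : forall l, 0 < l ->
  a (l * x) / a x @[x --> +oo] --> l `^ ((1 + theta) / (1 - beta)).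
Hypothesis akar : t * M t * phi (a t) / a t @[t --> +oo] --> (1 - beta)^-1.

(** The index of regular variation of [phi (c * a t)]. *)
Let gam := (1 + theta) / (1 - beta) * beta.

Let gam0 : 0 <= gam.
Proof. by rewrite /gam mulr_ge0// divr_ge0 ?subr_ge0 ?(ltW beta1)// addr_ge0. Qed.

Let gamE : 1 + gam = (1 + theta * beta) / (1 - beta).
Proof.
have h : 1 - beta != 0 by rewrite subr_eq0 gt_eqF.
by rewrite /gam; field.
Qed.

Lemma Beta_theta_gt0 : 0 < Beta (1 + theta) ((1 + theta * beta) / (1 - beta)).
Proof. by rewrite -gamE Beta_gt0. Qed.

Let phiay c : 0 < c -> phi (c * a t) @[t --> +oo] --> +oo.
Proof.
by move=> c0; apply: cvg_comp phiy; exact: gt0_cvgMry.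
Qed.

Let Mlim r : 0 <= r <= 1 -> M (t * r) / M t @[t --> +oo] --> powR_pos theta r.
Proof.
move=> /andP[r0 _]; rewrite /powR_pos; case: ifPn => [r_gt0|rn0].
  by under eq_fun do rewrite (mulrC _ r); exact: Mrv.
have -> : r = 0 by apply/eqP; rewrite eq_le r0 leNgt rn0.
by under eq_fun do rewrite mulr0; exact: cvg_div_cvgy.
Qed.

Let philim c r : 0 < c -> 0 <= r <= 1 ->
  phi (c * a (t * r)) / phi (c * a t) @[t --> +oo] --> powR_pos gam r.
Proof.
move=> c0 /andP[r0 _]; rewrite /powR_pos; case: ifPn => [r_gt0|rn0].
  rewrite /gam powRrM.
  apply: (@mono_ratio_cvg _ beta _ phi (fun t => c * a (t * r)) (fun t => c * a t)) => //.
  - exact: nearW.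
  - exact: gt0_cvgMry.
  - exact: powR_gt0.
  - have H := arv r_gt0.
    apply: cvg_trans H; apply: near_eq_cvg; near=> t.
    have h := a0 t.
    by rewrite (mulrC t); field; rewrite !gt_eqF.
have -> : r = 0 by apply/eqP; rewrite eq_le r0 leNgt rn0.
by under eq_fun do rewrite mulr0; apply: cvg_div_cvgy; exact: phiay.
Unshelve. all: by end_near. Qed.

(** The ratio is a product of three: [phi (c * a t) / phi (a t)], which gives [c^beta]; the
    convolution over [t * M t * phi (c * a t)], which gives the Beta integral; and
    [t * M t * phi (a t) / a t], which gives [(1 - beta)^-1]. *)
Lemma convolution_limit c : 0 < c ->
  (\int[lebesgue_measure]_(s in `[0, t]) (M (t - s) * phi (c * a s))) / a t
    @[t --> +oo] -->
  c `^ beta * (Beta (1 + theta) ((1 + theta * beta) / (1 - beta)) / (1 - beta)).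
Proof.
move=> c0; rewrite -gamE BetaE//.
have Gm : {homo (fun s => phi (c * a s)) : x y / x <= y}.
  by move=> x y xy; apply: phim; rewrite ler_pM2l//; exact: am.
have Mp : \forall t \near +oo, 0 < M t by move/cvgryPgt : My; exact.
have Gp : \forall t \near +oo, 0 < phi (c * a t) by exact: nearW.
have H := @conv_limit R M (fun s => phi (c * a s)) (powR_pos theta) (powR_pos gam)
  Mm Gm (powR_pos_mono theta0) (powR_pos_mono gam0) M0 (fun t => ltW (phi0 _))
  (powR_pos_ge0 _) (powR_pos_ge0 _) (powR_pos1 _) (powR_pos1 _) Mp
  Gp Mlim (fun r h => philim c0 h).
have Hc : phi (c * a t) / phi (a t) @[t --> +oo] --> c `^ beta.
  exact: (cvg_comp _ _ ay (phirv c0)).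
rewrite mulrA; apply: cvg_trans (cvgM (cvgM Hc H) akar); apply: near_eq_cvg; near=> t => /=.
have t0 : 0 < t by near: t; apply: nbhs_pinfty_gt; rewrite num_real.
have Mt : 0 < M t by near: t.
set I := Rintegral _ _ _.
have h1 := phi0 (a t); have h2 := phi0 (c * a t); have h3 := a0 t.
by rewrite /GRing.mul_fun/=; field; rewrite !gt_eqF.
Unshelve. all: by end_near. Qed.

(** The memory of a bounded initial time interval is at most a constant times [M t], so this limit
    makes it negligible against [a t]. The proof divides [akar] by [t * phi (a t)]. *)
Lemma cvg_M_div_a : M t / a t @[t --> +oo] --> (0 : R).
Proof.
have ty : t * phi (a t) @[t --> +oo] --> +oo.
  have := @phiay 1 ltr01; under eq_fun do rewrite mul1r; move=> /cvgryPge h.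
  apply/cvgryPge => A; near=> t.
  have t1 : 1 <= t by near: t; apply: nbhs_pinfty_ge; rewrite num_real.
  have h1 : A <= phi (a t) by near: t; exact: h.
  apply: (le_trans h1); rewrite ler_peMl//; exact: ltW.
rewrite -(mulr0 (1 - beta)^-1).
apply: cvg_trans (cvgM akar (cvg_div_cvgy 1 ty)); apply: near_eq_cvg; near=> t => /=.
have t0 : 0 < t by near: t; apply: nbhs_pinfty_gt; rewrite num_real.
have h1 := phi0 (a t); have h3 := a0 t.
by rewrite /GRing.mul_fun/=; field; rewrite !gt_eqF.
Unshelve. all: by end_near. Qed.

End convolution.

(** * Comparison with the solution *)

Lemma Rintegral_itv_le_cst (R : realType) (a b C : R) (g : R -> R) : a <= b ->
  lebesgue_measure.-integrable `[a, b] (EFin \o g) ->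
  (forall s, a <= s <= b -> g s <= C) ->
  \int[lebesgue_measure]_(s in `[a, b]) g s <= C * (b - a).
Proof.
move=> ab gi gC; rewrite -Rintegral_itv_cst//; apply: le_Rintegral => //.
exact: integrable_itv_cst.
Qed.

Lemma Rintegral_itv_ge_cst (R : realType) (a b C : R) (g : R -> R) : a <= b ->
  lebesgue_measure.-integrable `[a, b] (EFin \o g) ->
  (forall s, a <= s <= b -> C <= g s) ->
  C * (b - a) <= \int[lebesgue_measure]_(s in `[a, b]) g s.
Proof.
move=> ab gi gC; rewrite -Rintegral_itv_cst//; apply: le_Rintegral => //.
exact: integrable_itv_cst.
Qed.

Lemma integrable_itv_scale (R : realType) (a b e : R) (g : R -> R) :
  lebesgue_measure.-integrable `[a, b] (EFin \o g) ->
  lebesgue_measure.-integrable `[a, b] (EFin \o (fun s => e * g s)).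
Proof.
move=> gi.
have -> : EFin \o (fun s => e * g s) = (fun s => e%:E * (EFin \o g) s)%E.
  by apply/funext => s /=; rewrite EFinM.
exact: integrableZl.
Qed.

Section comparison.
Variables (R : realType) (beta xi K : R) (M phi a f x H : R -> R).
Hypotheses (beta0 : 0 <= beta) (beta1 : beta < 1) (K0 : 0 < K).
Hypotheses (Mm : {homo M : x y / x <= y}) (M0 : forall t, 0 <= M t).
Hypothesis My : M t @[t --> +oo] --> +oo.
Hypotheses (phim : {homo phi : x y / x <= y}) (phi0 : forall t, 0 < phi t).
Hypotheses (am : {homo a : x y / x <= y}) (a0 : forall t, 0 < a t).
Hypothesis ay : a t @[t --> +oo] --> +oo.
Hypothesis adbl : exists C : R, 0 < C /\ \forall t \near +oo, a (2 * t) <= C * a t.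
Hypothesis Jlim : forall c : R, 0 < c ->
  (\int[lebesgue_measure]_(s in `[0, t]) (M (t - s) * phi (c * a s))) / a t
    @[t --> +oo] --> c `^ beta * K.
Hypothesis Ma : M t / a t @[t --> +oo] --> (0 : R).
Hypothesis fc : {in `]0, +oo[, continuous f}.
Hypothesis fp : forall u : R, 0 < u -> 0 < f u.
Hypothesis fphi : f u / phi u @[u --> +oo] --> (1 : R).
Hypothesis xi0 : 0 < xi.
Hypothesis H0 : forall t : R, 0 < t -> 0 < H t.
Hypothesis xsol : is_solution M f H xi x.

Let I t := \int[lebesgue_measure]_(s in `[0, t]) (M (t - s) * f (x s)).
Let J c t := \int[lebesgue_measure]_(s in `[0, t]) (M (t - s) * phi (c * a s)).

Let xc : {within `[0, +oo[, continuous x}. Proof. by case: xsol. Qed.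
Let xp (t : R) : 0 <= t -> 0 < x t. Proof. by case: xsol => _ + _ _; exact. Qed.
Let xE (t : R) : 0 <= t -> x t = xi + I t + H t.
Proof. by case: xsol => _ _ _; exact. Qed.
Let x0E : x 0 = xi. Proof. by case: xsol. Qed.

Lemma conv_ge0 t : 0 <= I t.
Proof.
apply: Rintegral_ge0 => s /=; rewrite in_itv/= => /andP[s0 _].
by rewrite mulr_ge0// ltW// fp// xp.
Qed.

Lemma sol_ge_init t : 0 <= t -> xi <= x t.
Proof.
rewrite le_eqVlt => /predU1P[<-|t0]; first by rewrite x0E.
rewrite (xE (ltW t0)) -addrA lerDl addr_ge0 ?conv_ge0//.
exact/ltW/H0.
Qed.

Lemma sol_ge_conv t : 0 <= t -> I t <= x t.
Proof.
rewrite le_eqVlt => /predU1P[<-|t0].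
  by rewrite /I set_itv1 Rintegral_set1 ltW// xp.
rewrite (xE (ltW t0)) addrAC lerDr addr_ge0 ?(ltW xi0)//.
exact/ltW/H0.
Qed.

Lemma sol_ge_forcing t : 0 < t -> H t <= x t.
Proof.
by move=> t0; rewrite (xE (ltW t0)) lerDr addr_ge0 ?conv_ge0 ?(ltW xi0).
Qed.

Let xcT (b c : R) : 0 <= b -> {within `[b, c], continuous x}.
Proof.
move=> b0; apply: continuous_subspaceW xc => s /=.
by rewrite !in_itv/= andbT => /andP[bs _]; exact: le_trans bs.
Qed.

Let fxc (b c : R) : 0 <= b -> {within `[b, c], continuous (f \o x)}.
Proof.
move=> b0; have := @xcT b c b0; rewrite !subspace_continuousP => xcb s sbc.
apply: continuous_cvg; last exact: xcb.
apply: fc; rewrite in_itv/= andbT; apply: xp.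
by move: sbc => /=; rewrite in_itv/= => /andP[bs _]; exact: le_trans bs.
Qed.

Lemma fsol_bounded t : 0 <= t -> exists2 B, 0 <= B & forall s, 0 <= s <= t -> f (x s) <= B.
Proof.
move=> t0; have [c _ cB] := EVT_max t0 (@fxc 0 t (lexx _)).
exists `|f (x c)| => // s st; apply: le_trans (ler_norm _).
exact: cB.
Qed.

Lemma sol_bounded t : 0 <= t -> exists B, forall s, 0 <= s <= t -> x s <= B.
Proof.
move=> t0; have [c _ cB] := EVT_max t0 (@xcT 0 t (lexx _)).
by exists (x c) => s st; exact: cB.
Qed.

Lemma conv_integrable t b c : 0 <= b ->
  lebesgue_measure.-integrable `[b, c] (EFin \o (fun s => M (t - s) * f (x s))).
Proof.
move=> b0.
have [cb|bc] := ltP c b.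
  by rewrite set_itv_ge ?bnd_simp -?ltNge//; exact: integrable_set0.
have [B B0 fB] := fsol_bounded (le_trans b0 bc).
apply: (@bounded_integrable_itv _ _ _ (M (t - b) * B)).
  apply: measurable_funM.
    apply: nonincreasing_measurable => // u v uv; apply: Mm.
    by rewrite lerD2l lerN2.
  by apply: subspace_continuous_measurable_fun => //; exact: fxc.
move=> s /andP[bs sc]; have s0 := le_trans b0 bs.
rewrite ger0_norm; last by rewrite mulr_ge0// ltW// fp// xp.
apply: ler_pM => //; first by rewrite ltW// fp// xp.
  by apply: Mm; rewrite lerD2l lerN2.
by apply: fB; rewrite s0.
Qed.

Let Jm t : {homo (fun s => M (t - s)) : x y /~ x <= y}.
Proof. by move=> u v uv; apply: Mm; rewrite lerD2l lerN2. Qed.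

Let Jq (c : R) : 0 <= c -> {homo (fun s => phi (c * a s)) : x y / x <= y}.
Proof. by move=> c0 u v uv; apply: phim; rewrite ler_wpM2l//; exact: am. Qed.

Lemma J_integrable c t b d : 0 <= c ->
  lebesgue_measure.-integrable `[b, d] (EFin \o (fun s => M (t - s) * phi (c * a s))).
Proof.
move=> c0; apply: mono_product_integrable; [exact: Jm|exact: Jq|by []|].
by move=> s; exact: ltW.
Qed.

Lemma conv_ge_itv t b d : 0 <= b -> b <= d -> d <= t ->
  \int[lebesgue_measure]_(s in `[b, d]) (M (t - s) * f (x s)) <= I t.
Proof.
move=> b0 bd dt; rewrite /I.
rewrite (@Rintegral_itv_split _ 0 t b); [|exact: conv_integrable|by []|exact: le_trans dt].
rewrite (@Rintegral_itv_split _ b t d); [|exact: conv_integrable|by []|by []].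
have h u v : 0 <= u -> 0 <= \int[lebesgue_measure]_(s in `[u, v]) (M (t - s) * f (x s)).
  move=> u0; apply: Rintegral_ge0 => s /=; rewrite in_itv/= => /andP[us _].
  by rewrite mulr_ge0// ltW// fp// xp// (le_trans u0).
by rewrite addrCA lerDl addr_ge0// h// (le_trans b0).
Qed.

(** The equivalence of [f] and [phi] controls only large arguments; a minimum over a compact
    interval covers the rest. Starting at [xi] avoids the behaviour of [f] near 0 and is enough,
    since [x] stays above [xi]. *)
Lemma f_ge_phi : exists2 c1, 0 < c1 & forall u, xi <= u -> c1 * phi u <= f u.
Proof.
have [X [_ HX]] : \forall u \near +oo, 2^-1 < f u / phi u.
  by apply: (cvgr_gt _ fphi); lra.
pose Y := Num.max (X + 1) xi.
have xiY : xi <= Y by rewrite le_max lexx orbT.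
have XY : X + 1 <= Y by rewrite le_max lexx.
have fcY : {within `[xi, Y], continuous f}.
  apply: continuous_in_subspaceT => u; rewrite inE/= in_itv/= => /andP[xu _].
  by apply: fc; rewrite in_itv/= andbT (lt_le_trans xi0).
have [c] := EVT_min xiY fcY.
rewrite in_itv/= => /andP[xc' _] fmin.
have fc0 : 0 < f c by apply: fp; exact: lt_le_trans xc'.
exists (Num.min 2^-1 (f c / phi Y)).
  by rewrite lt_min invr_gt0 ltr0n divr_gt0.
move=> u xu; have [uY|Yu] := leP u Y.
  apply: (@le_trans _ _ (f c)); last by apply: fmin; rewrite in_itv/= xu.
  apply: (@le_trans _ _ (f c / phi Y * phi u)).
    by rewrite ler_wpM2r ?(ltW (phi0 _))// ge_min lexx orbT.
  rewrite mulrAC ler_pdivrMr// ler_pM2l//; exact: phim.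
apply: (@le_trans _ _ (2^-1 * phi u)).
  by rewrite ler_wpM2r ?(ltW (phi0 _))// ge_min lexx.
by rewrite -ler_pdivlMr// ltW//; apply: HX; lra.
Qed.

Lemma f_le_phi : exists2 c2, 0 < c2 & forall u, xi <= u -> f u <= c2 * phi u.
Proof.
have [X [_ HX]] : \forall u \near +oo, f u / phi u < 2.
  by apply: (cvgr_lt _ fphi); lra.
pose Y := Num.max (X + 1) xi.
have xiY : xi <= Y by rewrite le_max lexx orbT.
have XY : X + 1 <= Y by rewrite le_max lexx.
have fcY : {within `[xi, Y], continuous f}.
  apply: continuous_in_subspaceT => u; rewrite inE/= in_itv/= => /andP[xu _].
  by apply: fc; rewrite in_itv/= andbT (lt_le_trans xi0).
have [c] := EVT_max xiY fcY.
rewrite in_itv/= => /andP[xc' _] fmax.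
have fc0 : 0 < f c by apply: fp; exact: lt_le_trans xc'.
exists (Num.max 2 (f c / phi xi)).
  by rewrite lt_max ltr0n.
move=> u xu; have [uY|Yu] := leP u Y.
  apply: (@le_trans _ _ (f c)); first by apply: fmax; rewrite in_itv/= xu.
  apply: (@le_trans _ _ (f c / phi xi * phi u)).
    rewrite mulrAC ler_pdivlMr// ler_pM2l//; exact: phim.
  by rewrite ler_wpM2r ?(ltW (phi0 _))// le_max lexx orbT.
apply: (@le_trans _ _ (2 * phi u)).
  by rewrite -ler_pdivrMr// ltW//; apply: HX; lra.
by rewrite ler_wpM2r ?(ltW (phi0 _))// le_max lexx.
Qed.

(** On the first half [[0, t / 2]] of the memory, [M (t - s) >= M (t / 2)] and [f (x s)] stays above
    a positive constant, so divergence of [M] suffices. *)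
Lemma sol_cvgy : x t @[t --> +oo] --> +oo.
Proof.
have [c1 c10 fphi1] := f_ge_phi.
have k0 : 0 < c1 * phi xi by rewrite mulr_gt0.
apply/cvgryPge => A.
have [X [_ HX]] : \forall u \near +oo, `|A| / (c1 * phi xi) <= M u.
  by move/cvgryPge : My; exact.
near=> t.
have t2 : 2 <= t by near: t; apply: nbhs_pinfty_ge; rewrite num_real.
have Mt : `|A| / (c1 * phi xi) <= M (t / 2).
  apply: HX; rewrite ltr_pdivlMr//; near: t; apply: nbhs_pinfty_gt.
  by rewrite num_real.
apply: (@le_trans _ _ (I t)); last by apply: sol_ge_conv; lra.
apply: (@le_trans _ _
  (\int[lebesgue_measure]_(s in `[0, t / 2]) (M (t - s) * f (x s)))); last first.
  by apply: conv_ge_itv; lra.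
apply: (@le_trans _ _ (M (t / 2) * (c1 * phi xi) * (t / 2 - 0))).
  rewrite subr0; apply: (le_trans (ler_norm A)).
  rewrite ler_pdivrMr// in Mt; apply: (le_trans Mt).
  have h : 0 <= M (t / 2) * (c1 * phi xi) by apply: mulr_ge0 => //; exact: ltW.
  by rewrite ler_peMr//; rewrite ler_pdivlMr// mul1r.
apply: Rintegral_itv_ge_cst; [lra|exact: conv_integrable|].
move=> s /andP[s0 st]; apply: ler_pM => //; first exact: ltW.
  by apply: Mm; lra.
have xs := sol_ge_init s0.
by apply: le_trans (fphi1 _ xs); rewrite ler_pM2l//; exact: phim.
Unshelve. all: by end_near. Qed.


Lemma J_ge0 c t b d : 0 <=
  \int[lebesgue_measure]_(s in `[b, d]) (M (t - s) * phi (c * a s)).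
Proof. by apply: Rintegral_ge0 => s _; rewrite mulr_ge0// ltW. Qed.

Lemma J_le_cst c t t0 : 0 <= c -> 0 <= t0 ->
  \int[lebesgue_measure]_(s in `[0, t0]) (M (t - s) * phi (c * a s)) <=
  M t * (phi (c * a t0) * t0).
Proof.
move=> c0 t00; rewrite mulrA -[X in _ * _ * X]subr0.
apply: Rintegral_itv_le_cst => //; first exact: J_integrable.
move=> s /andP[s0 st]; apply: ler_pM => //; first exact: ltW.
  by apply: Mm; rewrite gerBl.
exact: Jq.
Qed.

(** From some [t0] on, [f (x s) >= e * phi (c * a s)] with [e < 1] close to 1. Replacing the
    integral over [[t0, t]] by [J c t] costs at most a multiple of [M t], which is negligible
    against [a t]. *)
Lemma conv_eventually_ge c m : 0 < c -> (\forall t \near +oo, c * a t <= x t) ->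
  m < c `^ beta * K -> \forall t \near +oo, m * a t <= I t.
Proof.
move=> c0 cax mK.
have [m0|m0] := leP m 0.
  near=> t; apply: (@le_trans _ _ 0); last exact: conv_ge0.
  by rewrite mulr_le0_ge0// ltW.
pose L := c `^ beta * K.
have L0 : 0 < L by rewrite mulr_gt0// powR_gt0.
(* [e] is the midpoint of [m / L] and 1. *)
have [e [e0 e1 meL]] : exists e, [/\ 0 < e, e < 1 & m < e * L].
  exists ((m / L + 1) / 2).
  have h : m / L < 1 by rewrite ltr_pdivrMr// mul1r.
  have h' : 0 < m / L by rewrite divr_gt0.
  split; [lra|lra|].
  have -> : (m / L + 1) / 2 * L = (m + L) / 2 by field; rewrite gt_eqF.
  rewrite /L in L0 *; lra.
have He : \forall u \near +oo, e < f u / phi u by apply: (cvgr_gt _ fphi).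
have [t1 [_ Ht1]] : \forall t \near +oo, e < f (x t) / phi (x t) := sol_cvgy He.
have [t2 [_ Ht2]] := cax.
pose t0 := Num.max 0 (Num.max (t1 + 1) (t2 + 1)).
have t00 : 0 <= t0 by rewrite le_max lexx.
have t01 : t1 + 1 <= t0 by rewrite !le_max lexx orbT.
have t02 : t2 + 1 <= t0 by rewrite !le_max lexx !orbT.
have fs s : t0 <= s -> e * phi (c * a s) <= f (x s).
  move=> ts.
  have h1 : e < f (x s) / phi (x s) by apply: Ht1; lra.
  have h2 : c * a s <= x s by apply: Ht2; lra.
  rewrite ltr_pdivlMr// in h1; apply: le_trans (ltW h1).
  by rewrite ler_pM2l//; exact: phim.
pose k := phi (c * a t0) * t0.
have lim : e * (J c t / a t - k * (M t / a t)) @[t --> +oo] --> e * (L - k * 0).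
  by apply: cvgMr; apply: cvgB; [exact: Jlim|exact: cvgMr].
rewrite mulr0 subr0 in lim.
have Hm : \forall t \near +oo, m < e * (J c t / a t - k * (M t / a t)).
  exact: (cvgr_gt _ lim).
near=> t.
have tt0 : t0 <= t by near: t; apply: nbhs_pinfty_ge; rewrite num_real.
have h1 : m < e * (J c t / a t - k * (M t / a t)) by near: t.
have h2 : e * (J c t / a t - k * (M t / a t)) * a t = e * (J c t - M t * k).
  by have ? := a0 t; field; rewrite gt_eqF.
apply: (@le_trans _ _ (e * (J c t - M t * k))).
  by rewrite -h2 ler_pM2r// ltW.
apply: le_trans (conv_ge_itv t00 tt0 (lexx t)).
have hJ := J_le_cst t (ltW c0) t00.
have ci := @J_integrable c t 0 t (ltW c0).
have ci' := @J_integrable c t t0 t (ltW c0).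
apply: (@le_trans _ _ (e *
  \int[lebesgue_measure]_(s in `[t0, t]) (M (t - s) * phi (c * a s)))).
  rewrite ler_pM2l// {1}/J (Rintegral_itv_split ci t00 tt0).
  by rewrite lerBlDl lerD2r.
rewrite -RintegralZl//; apply: le_Rintegral => //.
- exact: integrable_itv_scale.
- exact: conv_integrable.
move=> s /=; rewrite in_itv/= => /andP[s0 _].
by rewrite mulrCA ler_wpM2l// fs.
Unshelve. all: by end_near. Qed.

(** The mirror image, with [e > 1]; on [[0, t0]] the comparison with [a] may fail, and boundedness
    of [f (x s)] there costs a multiple of [M t]. *)
Lemma conv_eventually_le c m : 0 < c -> (\forall t \near +oo, x t <= c * a t) ->
  c `^ beta * K < m -> \forall t \near +oo, I t <= m * a t.
Proof.
move=> c0 cax mK.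
pose L := c `^ beta * K.
have L0 : 0 < L by rewrite mulr_gt0// powR_gt0.
have [e [e1 meL]] : exists e, [/\ 1 < e & e * L < m].
  exists ((m / L + 1) / 2).
  have h : 1 < m / L by rewrite ltr_pdivlMr// mul1r.
  split; [lra|].
  have -> : (m / L + 1) / 2 * L = (m + L) / 2 by field; rewrite gt_eqF.
  rewrite /L in L0 *; lra.
have e0 : 0 < e by lra.
have He : \forall u \near +oo, f u / phi u < e by apply: (cvgr_lt _ fphi).
have [t1 [_ Ht1]] : \forall t \near +oo, f (x t) / phi (x t) < e := sol_cvgy He.
have [t2 [_ Ht2]] := cax.
pose t0 := Num.max 0 (Num.max (t1 + 1) (t2 + 1)).
have t00 : 0 <= t0 by rewrite le_max lexx.
have t01 : t1 + 1 <= t0 by rewrite !le_max lexx orbT.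
have t02 : t2 + 1 <= t0 by rewrite !le_max lexx !orbT.
have fs s : t0 <= s -> f (x s) <= e * phi (c * a s).
  move=> ts.
  have h1 : f (x s) / phi (x s) < e by apply: Ht1; lra.
  have h2 : x s <= c * a s by apply: Ht2; lra.
  rewrite ltr_pdivrMr// in h1; apply: (le_trans (ltW h1)).
  by rewrite ler_pM2l//; exact: phim.
have [B B0 fB] := fsol_bounded t00.
pose k := B * t0.
have lim : e * (J c t / a t) + k * (M t / a t) @[t --> +oo] --> e * L + k * 0.
  by apply: cvgD; apply: cvgMr => //; exact: Jlim.
rewrite mulr0 addr0 in lim.
have Hm : \forall t \near +oo, e * (J c t / a t) + k * (M t / a t) < m.
  exact: (cvgr_lt _ lim).
near=> t.
have tt0 : t0 <= t by near: t; apply: nbhs_pinfty_ge; rewrite num_real.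
have h1 : e * (J c t / a t) + k * (M t / a t) < m by near: t.
have h2 : (e * (J c t / a t) + k * (M t / a t)) * a t = M t * k + e * J c t.
  by have ? := a0 t; field; rewrite gt_eqF.
apply: (@le_trans _ _ (M t * k + e * J c t)); last first.
  by rewrite -h2 ler_pM2r// ltW.
have ci := @J_integrable c t 0 t (ltW c0).
have ci' := @J_integrable c t t0 t (ltW c0).
rewrite /I (Rintegral_itv_split (conv_integrable t t (lexx 0)) t00 tt0).
apply: lerD.
  rewrite /k mulrA -[X in _ * _ * X]subr0.
  apply: Rintegral_itv_le_cst => //; first exact: conv_integrable.
  move=> s /andP[s0 st]; apply: ler_pM => //; first by rewrite ltW// fp// xp.
    by apply: Mm; rewrite gerBl.
  by apply: fB; rewrite s0.
apply: (@le_trans _ _ (e *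
  \int[lebesgue_measure]_(s in `[t0, t]) (M (t - s) * phi (c * a s)))); last first.
  by rewrite ler_pM2l// /J (Rintegral_itv_split ci t00 tt0) lerDr J_ge0.
rewrite -RintegralZl//; apply: le_Rintegral => //.
- exact: conv_integrable.
- exact: integrable_itv_scale.
move=> s /=; rewrite in_itv/= => /andP[s0 _].
by rewrite mulrCA ler_wpM2l// fs.
Unshelve. all: by end_near. Qed.


(** * Barriers below and above the solution *)

Let J_measurable (c t : R) : 0 <= c ->
  measurable_fun setT (fun s : R => M (t - s) * phi (c * a s)).
Proof.
move=> c0; apply: measurable_funM.
  by apply: nonincreasing_measurable => // u v uv; exact: Jm.
by apply: nondecreasing_measurable => // u v uv; exact: Jq.
Qed.

(** Sublinearity at work: for [A] large enough, the memory term of order [A^beta] fits under [A]. *)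
Let powR_balance k A : 0 < k -> 0 < A -> k <= A `^ (1 - beta) -> k * A `^ beta <= A.
Proof.
move=> k0 A0 kA.
apply: (@le_trans _ _ (A `^ (1 - beta) * A `^ beta)).
  by rewrite ler_pM2r ?powR_gt0.
by rewrite -powRD ?subrK ?powRr1 ?(ltW A0)// oner_eq0.
Qed.

(* A subsolution [d * a (t - T)], shifted far enough to start below [x]. *)
Lemma sol_liminf : exists d, 0 < d /\ \forall t \near +oo, d * a t <= x t.
Proof.
have [C [C0 [t1 [_ Ht1]]]] := adbl.
have [c1 c10 fphi1] := f_ge_phi.
have b1 : 0 < 1 - beta by rewrite subr_gt0.
(* [d] solves [d * C = c1 * (K / 2) * d^beta]: [C] pays for one doubling of time, [c1] for passing
   from [f] to [phi], and half of [K] is kept as the eventual lower bound for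
   [J d s / (d^beta * a s)]. *)
pose q := c1 * K / (2 * C).
have q0 : 0 < q by rewrite divr_gt0 ?mulr_gt0.
pose d := q `^ (1 - beta)^-1.
have d0 : 0 < d by rewrite powR_gt0.
have dq : d `^ (1 - beta) = q.
  by rewrite /d -powRrM mulVf ?gt_eqF// powRr1// ltW.
have dE : d = q * d `^ beta.
  by rewrite -dq -powRD ?subrK ?powRr1 ?(ltW d0)// oner_eq0//.
have db0 : 0 < d `^ beta by rewrite powR_gt0.
have [t2 [_ Ht2]] : \forall t \near +oo, K / 2 * d `^ beta < J d t / a t.
  apply: (cvgr_gt _ (Jlim d0)); rewrite [ltLHS]mulrC ltr_pM2l//; have := K0; lra.
pose t0 := Num.max 1 (Num.max (t1 + 1) (t2 + 1)).
have t01 : 1 <= t0 by rewrite !le_max lexx.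
have t02 : t1 + 1 <= t0 by rewrite !le_max lexx orbT.
have t03 : t2 + 1 <= t0 by rewrite !le_max lexx !orbT.
have [T [T0 HT]] : exists T, 0 <= T /\ forall t, T <= t -> d * a t0 <= x t.
  have [X [_ HX]] : \forall t \near +oo, d * a t0 <= x t.
    by have /cvgryPge := sol_cvgy; exact.
  exists (Num.max 0 (X + 1)); split; first by rewrite le_max lexx.
  by move=> t; rewrite ge_max => /andP[_ ?]; apply: HX; lra.
(* Induction over time blocks of length [t0]. In a new block only the memory up to the previous
   block's end [s] is used, where the bound is known; since [t <= 2 * s], the doubling bound
   recovers [a t] from [a s]. *)
have claim n t : 0 <= t -> t <= n.+1%:R * t0 -> d * a t <= x (T + t).
  elim: n t => [|n IH] t tge0 tle.
    apply: (@le_trans _ _ (d * a t0)); last by apply: HT; rewrite lerDl.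
    by rewrite ler_pM2l//; apply: am; rewrite mul1r in tle.
  have [ts|st] := leP t (n.+1%:R * t0); first exact: IH.
  pose s := n.+1%:R * t0; rewrite -/s in IH st.
  have st0 : t0 <= s by rewrite ler_peMl// ?ler1n//; lra.
  have t2s : t <= 2 * s.
    apply: (le_trans tle); rewrite -natr1 mulrDl mul1r -/s; lra.
  have h1 : a t <= C * a s.
    by apply: (@le_trans _ _ (a (2 * s))); [exact: am|apply: Ht1; lra].
  have h2 : K / 2 * d `^ beta * a s < J d s.
    by rewrite -ltr_pdivlMr//; apply: Ht2; lra.
  have h3 : d * a t <= c1 * J d s.
    apply: (@le_trans _ _ (d * (C * a s))); first by rewrite ler_pM2l.
    apply: (@le_trans _ _ (c1 * (K / 2 * d `^ beta * a s))); last first.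
      by rewrite ler_pM2l// ltW.
    rewrite [X in X * _ <= _]dE /q.
    have -> : c1 * K / (2 * C) * d `^ beta * (C * a s) = c1 * (K / 2 * d `^ beta * a s).
      by field; rewrite gt_eqF.
    exact: lexx.
  apply: (le_trans h3); apply: le_trans (sol_ge_conv (addr_ge0 T0 tge0)).
  have Ts : T <= T + s by lra.
  have Tt : T + s <= T + t by lra.
  apply: le_trans (conv_ge_itv T0 Ts Tt).
  pose g (u : R) := M (T + s - u) * phi (d * a (u - T)).
  have gm : measurable_fun setT g.
    apply: measurable_funM.
      by apply: nonincreasing_measurable => // u v uv; exact: Jm.
    apply: nondecreasing_measurable => // u v uv; apply: Jq; first exact: ltW.
    by rewrite lerD2r.
  have g0 u : 0 <= g u by rewrite mulr_ge0// ltW.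
  have gi : lebesgue_measure.-integrable `[T, T + s] (EFin \o g).
    apply: mono_product_integrable; [exact: Jm| |by []|by move=> ?; exact: ltW].
    by move=> u v uv; apply: Jq; [exact: ltW|rewrite lerD2r].
  have -> : J d s = \int[lebesgue_measure]_(u in `[T, T + s]) g u.
    have := @Rintegral_translate R 0 s T g gm g0.
    rewrite add0r (addrC s T) => <-.
    apply: eq_Rintegral => u _; rewrite /g addrK; congr (M _ * _); ring.
  rewrite -RintegralZl//; apply: le_Rintegral => //.
  - exact: integrable_itv_scale.
  - exact: conv_integrable.
  move=> u /=; rewrite in_itv/= => /andP[Tu us].
  rewrite /g mulrCA; apply: ler_pM => //.
  - by rewrite mulr_ge0// ltW.
  - by apply: Mm; lra.
  apply: (@le_trans _ _ (c1 * phi (x u))).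
    rewrite ler_pM2l//; apply: phim.
    by have := IH (u - T); rewrite subrKC; apply; lra.
  by apply: fphi1; apply: sol_ge_init; lra.
(* The shift is undone by [a t <= C * a (t / 2) <= C * a (t - T)] once [t >= 2 * T]. *)
exists (d / C); split; first by rewrite divr_gt0.
near=> t.
have tT : 2 * T <= t by near: t; apply: nbhs_pinfty_ge; rewrite num_real.
have tt1 : 2 * t1 < t by near: t; apply: nbhs_pinfty_gt; rewrite num_real.
have t0' : 0 <= t by near: t; apply: nbhs_pinfty_ge; rewrite num_real.
have h1 : a t <= C * a (t / 2).
  have e2 : 2 * (t / 2) = t by field.
  by have := Ht1 (t / 2); rewrite e2; apply; rewrite ltr_pdivlMr// mulrC.
have h2 : a (t / 2) <= a (t - T) by apply: am; lra.
have h3 : d * a (t - T) <= x t.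
  have := claim (Num.truncn ((t - T) / t0)) (t - T).
  rewrite subrKC; apply; first lra.
  by rewrite -ler_pdivrMr; [rewrite ltW// truncnS_gt|lra].
apply: le_trans h3; rewrite -mulrA ler_pM2l//.
rewrite mulrC ler_pdivrMr// mulrC; apply: (le_trans h1).
by rewrite ler_pM2l.
Unshelve. all: by end_near. Qed.

(* A supersolution [A * a (t + T)], shifted far enough to start above [x]. *)
Lemma sol_limsup lam : 0 <= lam -> (\forall t \near +oo, H t <= lam * a t) ->
  exists A, 0 < A /\ \forall t \near +oo, x t <= A * a t.
Proof.
move=> lam0 [tH [_ HtH]].
have [C [C0 [t1 [_ Ht1]]]] := adbl.
have [c2 c20 fphi2] := f_le_phi.
have b1 : 0 < 1 - beta by rewrite subr_gt0.
(* One factor 2 bounds [J A] by twice its limiting size, the other leaves only half of [A] to the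
   memory term; the other half pays for [xi] and the forcing, by [2 * (1 + lam) < A]. *)
pose q := 4 * c2 * K.
have q0 : 0 < q by rewrite !mulr_gt0.
pose A := Num.max (2 * (1 + lam)) (q `^ (1 - beta)^-1) + 1.
have A1 : 2 * (1 + lam) < A.
  by rewrite /A ltr_pwDr// le_max lexx.
have A0 : 0 < A by lra.
have Aq : q * A `^ beta <= A.
  apply: powR_balance => //.
  have -> : q = (q `^ (1 - beta)^-1) `^ (1 - beta).
    by rewrite -powRrM mulVf ?gt_eqF// powRr1// ltW.
  apply: ge0_ler_powR; rewrite ?nnegrE ?powR_ge0 ?(ltW A0) ?(ltW b1)//.
  by rewrite /A ler_wpDr// le_max lexx orbT.
have Ab0 : 0 < A `^ beta by rewrite powR_gt0.
have [t2 [_ Ht2]] : \forall t \near +oo, J A t / a t < 2 * (A `^ beta * K).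
  by apply: (cvgr_lt _ (Jlim A0)); rewrite ltr_pMl ?mulr_gt0// ltr1n.
(* Before [tH] the forcing is not controlled by [a], but [H <= x <= B] there; the shift [T] is taken
   so large that [a (t + T)] absorbs [xi] and [B]. *)
have [B xB] := sol_bounded (normr_ge0 tH).
have [T3 [_ HT3]] : \forall t \near +oo, xi + `|B| <= a t.
  by have /cvgryPge := ay; exact.
pose T := Num.max 0 (Num.max (t2 + 1) (T3 + 1)).
have T0 : 0 <= T by rewrite le_max lexx.
have T2 : t2 + 1 <= T by rewrite !le_max lexx orbT.
have T3' : T3 + 1 <= T by rewrite !le_max lexx !orbT.
have xiBa t : 0 <= t -> xi + `|B| <= a (t + T) by move=> t0; apply: HT3; lra.
have Hbound t : 0 < t -> xi + H t <= (1 + lam) * a (t + T).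
  move=> t0; rewrite mulrDl mul1r.
  have aT : a t <= a (t + T) by apply: am; lra.
  have lama : 0 <= lam * a (t + T) by rewrite mulr_ge0// ltW.
  have h := xiBa t (ltW t0).
  have [tt|tt] := ltP tH t.
    have : H t <= lam * a t by apply: HtH.
    have : lam * a t <= lam * a (t + T) by rewrite ler_wpM2l.
    have := normr_ge0 B; lra.
  have : x t <= B by apply: xB; rewrite (ltW t0) (le_trans tt)// ler_norm.
  have := sol_ge_forcing t0; have := ler_norm B; lra.
pose bnd t := x t <= A * a (t + T).
(* The bound before [t] yields a strict bound at [t]; the strictness lets the bound be continued
   past [t]. *)
have key t : 0 < t -> (forall s, 0 <= s -> s < t -> bnd s) -> x t < A * a (t + T).
  move=> t0 bs; rewrite xE ?(ltW t0)// addrAC.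
  have h1 := Hbound t t0.
  have h2 : J A (t + T) < 2 * (A `^ beta * K) * a (t + T).
    by rewrite -ltr_pdivrMr//; apply: Ht2; lra.
  suff h3 : I t <= c2 * J A (t + T).
    have h4 : c2 * J A (t + T) < c2 * (2 * (A `^ beta * K) * a (t + T)).
      by rewrite ltr_pM2l.
    have h5 : q * A `^ beta * a (t + T) <= A * a (t + T) by rewrite ler_pM2r.
    have h6 : 2 * (1 + lam) * a (t + T) < A * a (t + T) by rewrite ltr_pM2r.
    have h7 : c2 * (2 * (A `^ beta * K) * a (t + T)) = q * A `^ beta * a (t + T) / 2.
      by rewrite /q; field.
    rewrite h7 in h4; rewrite -mulrA in h6.
    move: h1 h3 h4 h5 h6; rewrite /I.
    by set P := _ * a (t + T); set Q := A * a (t + T); set U := q * _ * _; lra.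
  pose g (u : R) := M (t + T - u) * phi (A * a u).
  have gm : measurable_fun setT g by apply: J_measurable; exact: ltW.
  have g0 u : 0 <= g u by rewrite mulr_ge0// ltW.
  have gi b d : lebesgue_measure.-integrable `[b, d] (EFin \o g).
    by apply: J_integrable; exact: ltW.
  have hT : \int[lebesgue_measure]_(u in `[T, t + T]) g u <= J A (t + T).
    rewrite /J (@Rintegral_itv_split _ 0 (t + T) T); [|exact: gi|by []|lra].
    by rewrite lerDr J_ge0.
  apply: (@le_trans _ _ (c2 * \int[lebesgue_measure]_(u in `[T, t + T]) g u)); last first.
    by rewrite ler_pM2l.
  have := @Rintegral_translate R 0 t T g gm g0; rewrite add0r => <-.
  have gi' : lebesgue_measure.-integrable `[0, t] (EFin \o (fun s => g (s + T))).
    have -> : (fun s => g (s + T)) = (fun s => M (t - s) * phi (A * a (s + T))).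
      by apply/funext => s; rewrite /g; congr (M _ * _); ring.
    apply: mono_product_integrable; [exact: Jm| |by []|by move=> ?; exact: ltW].
    by move=> u v uv; apply: Jq; [exact: ltW|rewrite lerD2r].
  rewrite -RintegralZl// /I.
  have ci := conv_integrable t t (lexx 0).
  have gi2 := integrable_itv_scale c2 gi'.
  have sub : `[0, t[%classic `<=` `[0, t]%classic by exact: subset_itv_co_cc.
  have ci1 : lebesgue_measure.-integrable `[0, t[ (EFin \o (fun s => M (t - s) * f (x s))).
    exact: integrableS ci.
  have gi3 : lebesgue_measure.-integrable `[0, t[ (EFin \o (fun s => c2 * g (s + T))).
    exact: integrableS gi2.
  (* The end point [s = t] is dropped, since the bound is assumed only for [s < t]. *)
  rewrite -(Rintegral_itv_bndo_bndc ci1) -(Rintegral_itv_bndo_bndc gi3).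
  apply: le_Rintegral => //.
  move=> s /=; rewrite in_itv/= => /andP[s0 st].
  have -> : g (s + T) = M (t - s) * phi (A * a (s + T)).
    by rewrite /g; congr (M _ * _); ring.
  rewrite mulrCA ler_wpM2l//; apply: (le_trans (fphi2 _ (sol_ge_init s0))).
  by rewrite ler_pM2l//; apply: phim; exact: bs.
(* Continuation argument at the last time [sg] up to which the bound holds. It is strict at [sg] by
   [key]; continuity of [x] extends it beyond [sg], and on the barrier side monotonicity of [a]
   replaces continuity. *)
have all t : 0 <= t -> bnd t.
  move=> t0; apply: contrapT => /negP; rewrite -ltNge => bad.
  pose S := [set u | 0 <= u /\ forall s, 0 <= s -> s <= u -> bnd s].
  have S0 : S 0.
    split=> // s s0 s0'; have -> : s = 0 by apply/eqP; rewrite eq_le s0 s0'.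
    rewrite /bnd x0E add0r.
    have := xiBa 0 (lexx _); rewrite add0r => h.
    apply: (@le_trans _ _ (a T)); first by have := normr_ge0 B; lra.
    by rewrite ler_peMl ?ltW//; lra.
  have Sub : has_ubound S.
    exists t => u [u0 Su]; rewrite leNgt; apply/negP => tu.
    by have := Su t t0 (ltW tu); rewrite /bnd leNgt bad.
  pose sg := sup S.
  have sg0 : 0 <= sg by apply: ub_le_sup.
  have below s : 0 <= s -> s < sg -> bnd s.
    move=> s0 ssg; have sS : has_sup S by split => //; exists 0.
    have es : 0 < sg - s by rewrite subr_gt0.
    have [u [u0 Su] su] := sup_adherent es sS.
    apply: Su => //; move: su; rewrite -/sg; lra.
  have at_sg : x sg < A * a (sg + T).
    move: sg0; rewrite le_eqVlt => /predU1P[<-|sgp]; last exact: key.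
    rewrite x0E add0r.
    have := xiBa 0 (lexx _); rewrite add0r => h.
    apply: (@le_lt_trans _ _ (a T)); first by have := normr_ge0 B; lra.
    by rewrite ltr_pMl//; lra.
  have := xc; rewrite subspace_continuousP => xcw.
  have sgin : `[0, +oo[%classic sg by rewrite /= in_itv/= sg0.
  have near_sg : \forall s \near within `[0, +oo[ (nbhs sg), x s < A * a (sg + T).
    exact: (cvgr_lt _ (xcw sg sgin) _ at_sg).
  move: near_sg; rewrite near_withinE => /nbhs_ballP [r /= r0 hr].
  have Sr : S (sg + r / 2).
    split; first by lra.
    move=> s s0 ss; have [ssg|sgs] := ltP s sg; first exact: below.
    rewrite /bnd; apply: (@le_trans _ _ (A * a (sg + T))).
      apply/ltW/hr; last by rewrite /= in_itv/= s0.
      by rewrite /ball/= ler0_norm; lra.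
    by rewrite ler_pM2l//; apply: am; lra.
  have := ub_le_sup Sub Sr; rewrite -/sg; lra.
(* The forward shift is removed by doubling, since [t + T <= 2 * t] eventually. *)
exists (A * C); split; first exact: mulr_gt0.
near=> t.
have tT : T <= t by near: t; apply: nbhs_pinfty_ge; rewrite num_real.
have tt1 : t1 < t by near: t; apply: nbhs_pinfty_gt; rewrite num_real.
apply: (le_trans (all t _)); first lra.
rewrite -mulrA ler_pM2l//; apply: (@le_trans _ _ (a (2 * t))); first by apply: am; lra.
exact: Ht1.
Unshelve. all: by end_near. Qed.


(** * Exact limits of the ratios *)

Lemma conv_ratio_cvg (z : R) : 0 < z -> x t / a t @[t --> +oo] --> z ->
  I t / a t @[t --> +oo] --> z `^ beta * K.
Proof.
move=> z0 xz; apply: cvg_pinfty_between => m mz.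
- have mK : m / K < z `^ beta by rewrite ltr_pdivrMr.
  have [d [d0 dz md]] := powR_approx_lt z0 mK.
  rewrite ltr_pdivrMr// in md.
  have dx : \forall t \near +oo, d * a t <= x t.
    have h : \forall t \near +oo, d < x t / a t by exact: (cvgr_gt _ xz).
    by apply: filterS h => t; rewrite ltr_pdivlMr// => /ltW.
  apply: filterS (conv_eventually_ge d0 dx md) => t.
  by rewrite ler_pdivlMr.
- have mK : z `^ beta < m / K by rewrite ltr_pdivlMr.
  have [d [dz md]] := powR_approx_gt z0 mK.
  rewrite ltr_pdivlMr// in md.
  have d0 : 0 < d by exact: lt_trans dz.
  have dx : \forall t \near +oo, x t <= d * a t.
    have h : \forall t \near +oo, x t / a t < d by exact: (cvgr_lt _ xz).
    by apply: filterS h => t; rewrite ltr_pdivrMr// => /ltW.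
  apply: filterS (conv_eventually_le d0 dx md) => t.
  by rewrite ler_pdivrMr.
Qed.

Lemma forcing_ratio_cvg (z : R) : 0 < z -> x t / a t @[t --> +oo] --> z ->
  H t / a t @[t --> +oo] --> z - z `^ beta * K.
Proof.
move=> z0 xz; rewrite -[z in z - _](subr0 z).
have lim : x t / a t - xi / a t - I t / a t @[t --> +oo] --> z - 0 - z `^ beta * K.
  apply: cvgB; last exact: conv_ratio_cvg.
  by apply: cvgB => //; exact: cvg_div_cvgy.
apply: cvg_trans lim; apply: near_eq_cvg; near=> t.
have t0 : 0 <= t by near: t; apply: nbhs_pinfty_ge; rewrite num_real.
by rewrite (xE t0); ring.
Unshelve. all: by end_near. Qed.

Lemma sol_ratio_cvg (lam : R) : 0 <= lam -> H t / a t @[t --> +oo] --> lam ->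
  exists z : R, [/\ 0 < z, z = z `^ beta * K + lam & x t / a t @[t --> +oo] --> z].
Proof.
move=> lam0 Hl.
have Hhi e : 0 < e -> \forall t \near +oo, H t <= (lam + e) * a t.
  move=> e0; have h : \forall t \near +oo, H t / a t < lam + e.
    by apply: (cvgr_lt _ Hl); rewrite ltrDl.
  by apply: filterS h => t; rewrite ltr_pdivrMr// => /ltW.
have Hlo e : 0 < e -> \forall t \near +oo, (lam - e) * a t <= H t.
  move=> e0; have h : \forall t \near +oo, lam - e < H t / a t.
    by apply: (cvgr_gt _ Hl); rewrite gtrBl.
  by apply: filterS h => t; rewrite ltr_pdivlMr// => /ltW.
pose g z := z `^ beta * K + lam.
have gle z w : 0 < z -> z <= w -> g z <= g w.
  move=> z0 zw; rewrite lerD2r ler_pM2r//; apply: ge0_ler_powR => //.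
  - by rewrite nnegrE ltW.
  - by rewrite nnegrE ltW// (lt_le_trans z0).
(* [sup Lo] and [inf Up] stand for the lower and upper limits of [x t / a t]; the two barriers make
   both sets inhabited. *)
pose Lo := [set z | 0 < z /\ \forall t \near +oo, z * a t <= x t].
pose Up := [set z | 0 < z /\ \forall t \near +oo, x t <= z * a t].
have [l1 L1] : exists z, Lo z by have [d] := sol_liminf; exists d.
have [u1 U1] : exists z, Up z.
  have lam1 : 0 <= lam + 1 by rewrite addr_ge0.
  by have [A] := sol_limsup lam1 (Hhi 1 ltr01); exists A.
have LU l u : Lo l -> Up u -> l <= u.
  move=> [l0 Ll] [u0 Uu]; near (pinfty_nbhs R) => t.
  rewrite -(ler_pM2r (a0 t)); apply: (@le_trans _ _ (x t)); near: t; [exact: Ll|exact: Uu].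
have Lub : has_ubound Lo by exists u1 => l Ll; exact: LU U1.
have Ulb : has_lbound Up by exists l1 => u Uu; exact: LU L1 Uu.
have sL : has_sup Lo by split => //; exists l1.
have sU : has_inf Up by split => //; exists u1.
pose l := sup Lo; pose u := inf Up.
have l0 : 0 < l by case: L1 (ub_le_sup Lub L1) => l10 _; exact: lt_le_trans.
have lu : l <= u.
  apply: lb_le_inf; first by exists u1.
  move=> w Uw; apply: ge_sup; first by exists l1.
  by move=> v Lv; exact: LU Uw.
have u0 : 0 < u by exact: lt_le_trans lu.
have step_lo v : Lo v -> g v <= l.
  move=> [v0 Lv]; rewrite leNgt; apply/negP => lg.
  (* Of the gap [2 * e], the memory loses [e] and the forcing [e / 2]; the remaining [e / 2] would
     put [l + e / 2] into [Lo]. *)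
  pose e := (g v - l) / 2.
  have e0 : 0 < e by rewrite divr_gt0// subr_gt0.
  have h1 : \forall t \near +oo, (v `^ beta * K - e) * a t <= I t.
    by apply: (conv_eventually_ge v0 Lv); rewrite gtrBl.
  pose e' := e / 2; have e'0 : 0 < e' by rewrite divr_gt0.
  have h2 := Hlo e' e'0.
  have : Lo (l + e').
    split; first exact: addr_gt0.
    near=> t.
    have t0 : 0 <= t by near: t; apply: nbhs_pinfty_ge; rewrite num_real.
    have k1 : (v `^ beta * K - e) * a t <= I t by near: t.
    have k2 : (lam - e') * a t <= H t by near: t.
    have -> : l + e' = (v `^ beta * K - e) + (lam - e') by rewrite /e' /e /g; field.
    rewrite (xE t0) mulrDl -addrA; apply: ler_wpDl; first exact: ltW.
    exact: lerD.
  move=> /(ub_le_sup Lub); rewrite -/l leNgt ltrDl e'0//.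
have step_up w : Up w -> u <= g w.
  move=> [w0 Uw]; rewrite leNgt; apply/negP => gu.
  (* A quarter each for [xi], the memory and the forcing; the last quarter would put [u - e] into
     [Up]. *)
  pose e := (u - g w) / 4.
  have e0 : 0 < e by rewrite divr_gt0// subr_gt0.
  have h1 : \forall t \near +oo, I t <= (w `^ beta * K + e) * a t.
    by apply: (conv_eventually_le w0 Uw); rewrite ltrDl.
  have h2 := Hhi e e0.
  have h3 : \forall t \near +oo, xi / e <= a t by have /cvgryPge := ay; exact.
  have gw0 : 0 < g w by rewrite ltr_pwDl// mulr_gt0// powR_gt0.
  have : Up (u - e).
    split.
      have -> : u - e = g w + 3 * e by rewrite /e; field.
      by rewrite addr_gt0// mulr_gt0.
    near=> t.
    have t0 : 0 <= t by near: t; apply: nbhs_pinfty_ge; rewrite num_real.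
    have k1 : I t <= (w `^ beta * K + e) * a t by near: t.
    have k2 : H t <= (lam + e) * a t by near: t.
    have k3 : xi / e <= a t by near: t.
    rewrite ler_pdivrMr// mulrC in k3.
    have -> : u - e = e + (w `^ beta * K + e) + (lam + e) by rewrite /e /g; field.
    by rewrite (xE t0) !mulrDl; apply: lerD; [apply: lerD => //|]; rewrite -?mulrDl.
  move=> /(ge_inf Ulb); rewrite -/u leNgt gtrBl e0//.
(* [l] itself need not lie in [Lo], so [step_lo] is applied to a member close to it, found by
   continuity of the power. *)
have gl : g l <= l.
  rewrite leNgt; apply/negP => lg.
  have h : (l - lam) / K < l `^ beta by rewrite ltr_pdivrMr// ltrBlDr.
  have [d [d0 dl hd]] := powR_approx_lt l0 h.
  rewrite ltr_pdivrMr// ltrBlDr in hd.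
  have ld : 0 < l - d by rewrite subr_gt0.
  have [v Lv] := sup_adherent ld sL; rewrite -/l subKr => dv.
  have := step_lo v Lv; rewrite leNgt => /negP; apply.
  by apply: (lt_le_trans hd); apply: gle => //; exact: ltW.
have gu : u <= g u.
  rewrite leNgt; apply/negP => ug.
  have h : u `^ beta < (u - lam) / K by rewrite ltr_pdivlMr// ltrBrDr.
  have [d [du hd]] := powR_approx_gt u0 h.
  rewrite ltr_pdivlMr// ltrBrDr in hd.
  have ud : 0 < d - u by rewrite subr_gt0.
  have [w Uw] := inf_adherent ud sU; rewrite -/u subrKC => wd.
  have := step_up w Uw; rewrite leNgt => /negP; apply.
  by apply: le_lt_trans hd; apply: gle; [case: Uw|exact: ltW].
(* If [l = r * u] with [r < 1], then [r < r^beta] gives [g l > r * g u >= r * u = l], against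
   [g l <= l]. *)
have luE : l = u.
  apply/eqP; rewrite eq_le lu leNgt; apply/negP => ltlu.
  pose r := l / u.
  have r0 : 0 < r by rewrite divr_gt0.
  have r1 : r < 1 by rewrite ltr_pdivrMr// mul1r.
  have lE : l = r * u by rewrite /r divfK// gt_eqF.
  have rb : r < r `^ beta.
    rewrite -[ltLHS]powRr1 ?(ltW r0)// -[X in r `^ X](subrK beta) powRD; last first.
      by rewrite subrK oner_eq0.
    rewrite gtr_pMl ?powR_gt0//.
    have b1 : 0 < 1 - beta by rewrite subr_gt0.
    have := @gt0_ltr_powR R _ b1 r 1; rewrite powR1; apply => //.
      by rewrite nnegrE ltW.
    by rewrite nnegrE.
  have ub0 : 0 < u `^ beta * K by rewrite mulr_gt0// powR_gt0.
  move: gl; rewrite {1}/g lE powRM ?(ltW r0) ?(ltW u0)// leNgt => /negP; apply.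
  apply: (@le_lt_trans _ _ (r * g u)); first by rewrite ler_pM2l.
  rewrite /g mulrDr -mulrA; apply: ltr_leD; first by rewrite ltr_pM2r.
  by rewrite ler_piMl// ltW.
exists l; split=> //.
  by apply/eqP; rewrite eq_le gl {1}luE andbT luE.
apply: cvg_pinfty_between => m ml.
- have lm : 0 < l - m by rewrite subr_gt0.
  have [v [v0 Lv]] := sup_adherent lm sL; rewrite -/l subKr => mv.
  apply: filterS Lv => t h; rewrite ler_pdivlMr//; apply: le_trans h.
  by rewrite ler_pM2r// ltW.
- have um : 0 < m - u by rewrite subr_gt0 -luE.
  have [w [w0 Uw]] := inf_adherent um sU; rewrite -/u subrKC => wm.
  apply: filterS Uw => t h; rewrite ler_pdivrMr//; apply: (le_trans h).
  by rewrite ler_pM2r// ltW.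
Unshelve. all: by end_near. Qed.

End comparison.

(** * The growth rate F^-1 (t M t) *)

Section cumul.
Variables (R : realType) (mu : {measure set (measurableTypeR R) -> \bar R}).
Hypothesis mu_fin : forall t : R, 0 <= t -> (mu `[0%R, t]%classic < +oo)%E.

(** The interval is empty for [t < 0], so [M] vanishes there; this makes [M] and [t * M t]
    nondecreasing on the whole line, as the convolution lemmas and the monotonicity of [a]
    require. *)
Lemma cumul_lt0 t : t < 0 -> cumul mu t = 0.
Proof.
by move=> t0; rewrite /cumul set_itv_ge ?measure0//= bnd_simp -ltNge.
Qed.

Lemma cumul_ge0 t : 0 <= cumul mu t.
Proof. exact: fine_ge0. Qed.

Lemma cumul_mono : {homo cumul mu : s t / s <= t}.
Proof.
move=> s t st; have [s0|s0] := ltP s 0; first by rewrite cumul_lt0// cumul_ge0.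
have fin u : 0 <= u -> mu `[0, u]%classic \is a fin_num.
  by move=> u0; rewrite ge0_fin_numE//; exact: mu_fin.
have t0 := le_trans s0 st.
apply: fine_le; [exact: fin|exact: fin|].
by apply: le_measure; rewrite ?inE//; exact: subset_itvl.
Qed.

Lemma mul_cumul_mono : {homo (fun t => t * cumul mu t) : s t / s <= t}.
Proof.
move=> s t st /=; have [s0|s0] := ltP s 0; last first.
  by apply: ler_pM => //; [exact: cumul_ge0|exact: cumul_mono].
rewrite cumul_lt0// mulr0; have [t0|t0] := ltP t 0; first by rewrite cumul_lt0// mulr0.
by rewrite mulr_ge0// cumul_ge0.
Qed.

Lemma mul_cumul_ge0 t : 0 <= t * cumul mu t.
Proof.
have [t0|t0] := ltP t 0; first by rewrite cumul_lt0// mulr0.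
by rewrite mulr_ge0// cumul_ge0.
Qed.

End cumul.

Section growth.
Variables (R : realType) (theta beta : R) (M f phi : R -> R).
Hypotheses (theta0 : 0 <= theta) (beta1 : beta < 1).
Hypothesis My : M t @[t --> +oo] --> +oo.
Hypothesis Mrv : forall l : R, 0 < l -> M (l * x) / M x @[x --> +oo] --> l `^ theta.
Hypothesis tMm : {homo (fun t => t * M t) : s t / s <= t}.
Hypothesis tM0 : forall t, 0 <= t * M t.
Hypothesis fc : {in `]0, +oo[, continuous f}.
Hypothesis fp : forall u : R, 0 < u -> 0 < f u.
Hypothesis frv : forall l : R, 0 < l -> f (l * x) / f x @[x --> +oo] --> l `^ beta.
Hypotheses (phim : {homo phi : x y / x <= y}) (phi0 : forall t, 0 < phi t).
Hypothesis fphi : f u / phi u @[u --> +oo] --> (1 : R).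

Let a t := Finv f (t * M t).

Let a1 t : 1 <= a t. Proof. by have [] := FinvK beta1 fc fp frv (tM0 t). Qed.

Let Fa t : Fint f (a t) = t * M t.
Proof. by have [] := FinvK beta1 fc fp frv (tM0 t). Qed.

Lemma growth_gt0 t : 0 < a t. Proof. exact: lt_le_trans (a1 t). Qed.

Lemma growth_mono : {homo a : x y / x <= y}.
Proof.
move=> s t st; rewrite leNgt; apply/negP => /(Fint_lt fc fp (a1 t)).
by rewrite !Fa ltNge tMm.
Qed.

Lemma growth_cvgy : a t @[t --> +oo] --> +oo.
Proof.
apply/cvgryPge => A; pose B := Num.max 1 A.
have HM : \forall t \near +oo, `|Fint f B| + 1 <= M t by have /cvgryPge := My; exact.
near=> t.
have t1 : 1 <= t by near: t; apply: nbhs_pinfty_ge; rewrite num_real.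
have Mt : `|Fint f B| + 1 <= M t by near: t.
have tM : `|Fint f B| + 1 <= t * M t.
  by apply: (le_trans Mt); rewrite ler_peMl// (le_trans _ Mt)// addr_ge0.
apply: (@le_trans _ _ B); first by rewrite le_max lexx orbT.
rewrite leNgt; apply/negP => /(Fint_lt fc fp (a1 t)); rewrite Fa.
by have := ler_norm (Fint f B); lra.
Unshelve. all: by end_near. Qed.

(** Through [F], the ratio becomes [l * (M (l * t) / M t)], which tends to [l^(1 + theta)]. As [F]
    has index [1 - beta], taking the corresponding root gives the exponent. *)
Lemma growth_rv l : 0 < l ->
  a (l * t) / a t @[t --> +oo] --> l `^ ((1 + theta) / (1 - beta)).
Proof.
move=> l0; rewrite powRrM.
have k0 : 0 < 1 - beta by rewrite subr_gt0.
(* Monotonicity of [F] is established from 1 on, and [a] takes its values there; [G] freezes [F] to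
   the left of 1. *)
pose G x := Fint f (Num.max 1 x).
have GE x : 1 <= x -> G x = Fint f x by move=> x1; rewrite /G max_r.
have Gm : {homo G : x y / x <= y}.
  move=> x y xy; apply: Fint_le => //; first by rewrite le_max lexx.
  by rewrite ge_max !le_max lexx xy orbT.
have Gp : \forall x \near +oo, 0 < G x.
  near=> x.
  have x1 : 1 < x by near: x; apply: nbhs_pinfty_gt; rewrite num_real.
  by rewrite GE ?ltW//; exact: Fint_gt0.
have Grv c : 0 < c -> G (c * x) / G x @[x --> +oo] --> c `^ (1 - beta).
  move=> c0; apply: cvg_trans (Fint_rv fc fp beta1 frv c0).
  apply: near_eq_cvg; near=> x.
  have x1 : 1 <= x by near: x; apply: nbhs_pinfty_ge; rewrite num_real.
  have x2 : 1 / c <= x by near: x; apply: nbhs_pinfty_ge; rewrite num_real.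
  by rewrite ler_pdivrMr// mulrC in x2; rewrite !GE.
apply: (@mono_ratio_cvg_inv _ _ _ G (fun t => a (l * t)) a) => //.
- exact: growth_cvgy.
- by apply: nearW => t; exact: growth_gt0.
- exact: powR_gt0.
have lim : l * (M (l * t) / M t) @[t --> +oo] --> l * l `^ theta.
  by apply: cvgMr; exact: Mrv.
have -> : l `^ (1 + theta) = l * l `^ theta.
  rewrite powRD; last by rewrite (gt_eqF l0) implybT.
  by rewrite powRr1// ltW.
apply: cvg_trans lim; apply: near_eq_cvg; near=> t.
have t0 : 0 < t by near: t; apply: nbhs_pinfty_gt; rewrite num_real.
have Mt : 0 < M t by near: t; move/cvgryPgt : My; exact.
rewrite !GE ?a1// !Fa; field; by rewrite !gt_eqF.
Unshelve. all: by end_near. Qed.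

Lemma growth_doubling :
  exists C : R, 0 < C /\ \forall t \near +oo, a (2 * t) <= C * a t.
Proof.
pose L : R := 2 `^ ((1 + theta) / (1 - beta)).
have L0 : 0 < L by rewrite powR_gt0.
exists (L + 1); split; first by rewrite addr_gt0.
have h : \forall t \near +oo, a (2 * t) / a t < L + 1.
  by apply: (cvgr_lt _ (@growth_rv 2 _)) => //; rewrite ltrDl.
by apply: filterS h => t; rewrite ltr_pdivrMr ?growth_gt0// => /ltW.
Qed.

Lemma growth_karamata :
  t * M t * phi (a t) / a t @[t --> +oo] --> (1 - beta)^-1.
Proof.
have k0 : 0 < 1 - beta by rewrite subr_gt0.
have kar := karamata beta1 fc fp frv phim phi0 fphi.
have lim : (a t / (phi (a t) * Fint f (a t)))^-1 @[t --> +oo] --> (1 - beta)^-1.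
  apply: cvgV; first by rewrite gt_eqF.
  exact: (cvg_comp _ _ growth_cvgy kar).
apply: cvg_trans lim; apply: near_eq_cvg; near=> t.
by rewrite Fa invf_div (mulrC (phi _)).
Unshelve. all: by end_near. Qed.

End growth.


Unset Implicit Arguments.

Theorem theorem5 (R : realType)
    (mu : {measure set (measurableTypeR R) -> \bar R})
    (theta beta xi : R) (f h x : R -> R)
    (* mu is a Borel measure on [0, oo), seen as a measure on R *)
    (mu_supp : mu `]-oo, 0[%classic = 0%E)
    (mu_fin : forall t : R, 0 <= t -> (mu `[0%R, t]%classic < +oo)%E)
    (M_oo : cumul mu t @[t --> +oo] --> +oo)
    (theta_ge0 : 0 <= theta)
    (M_RV : regularly_varying theta (cumul mu))
    (f_ge0 : forall u : R, 0 <= u -> 0 <= f u)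
    (f_cont : {in `]0, +oo[, continuous f})
    (f_gt0 : forall u : R, 0 < u -> 0 < f u)
    (beta_ge0 : 0 <= beta) (beta_lt1 : beta < 1)
    (f_RV : regularly_varying beta f)
    (f_beta0 : beta = 0 -> asymp_increasing f /\ f u @[u --> +oo] --> +oo)
    (h_loc : locally_integrable_halfline h)
    (H_cont : {in `]0, +oo[, continuous (primitive0 h)})
    (H_gt0 : forall t : R, 0 < t -> 0 < primitive0 h t)
    (xi_gt0 : 0 < xi)
    (x_sol : is_solution (cumul mu) f (primitive0 h) xi x) :
  ((exists zeta : R, Lconst theta beta <= zeta /\
      x t / Finv f (t * cumul mu t) @[t --> +oo] --> zeta)
   <->
   (exists lambda : R, 0 <= lambda /\
      primitive0 h t / Finv f (t * cumul mu t) @[t --> +oo] --> lambda))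
  /\
  (forall zeta lambda : R,
      Lconst theta beta <= zeta ->
      x t / Finv f (t * cumul mu t) @[t --> +oo] --> zeta ->
      0 <= lambda ->
      primitive0 h t / Finv f (t * cumul mu t) @[t --> +oo] --> lambda ->
      zeta = zeta `^ beta / (1 - beta)
               * Beta (1 + theta) ((1 + theta * beta) / (1 - beta))
             + lambda).
Proof.
have [_ _ frv] := f_RV; have [_ _ Mrv] := M_RV.
have [phi [phim phi0 fphi phiy phirv]] :=
  rv_monotone_equiv beta_ge0 f_cont f_gt0 f_RV f_beta0.
have Mm := cumul_mono mu_fin; have M0 := cumul_ge0 mu.
have tMm := mul_cumul_mono mu_fin; have tM0 := mul_cumul_ge0 mu.
pose a t := Finv f (t * cumul mu t).
have a0 : forall t, 0 < a t := growth_gt0 beta_lt1 tM0 f_cont f_gt0 frv.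
have am : {homo a : s t / s <= t} := growth_mono beta_lt1 tMm tM0 f_cont f_gt0 frv.
have ay : a t @[t --> +oo] --> +oo := growth_cvgy beta_lt1 M_oo tM0 f_cont f_gt0 frv.
have arv : forall l : R, 0 < l -> a (l * t) / a t @[t --> +oo] --> _ :=
  growth_rv beta_lt1 M_oo Mrv tM0 f_cont f_gt0 frv.
have adbl := growth_doubling beta_lt1 M_oo Mrv tM0 f_cont f_gt0 frv.
have akar := growth_karamata beta_lt1 M_oo tM0 f_cont f_gt0 frv phim phi0 fphi.
pose K := Beta (1 + theta) ((1 + theta * beta) / (1 - beta)) / (1 - beta).
have k0 : 0 < 1 - beta by rewrite subr_gt0.
have K0 : 0 < K by rewrite divr_gt0// Beta_theta_gt0.
have Jlim := convolution_limit theta_ge0 beta_ge0 beta_lt1 Mm M0 M_oo Mrv phim phi0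
  phiy phirv am a0 ay arv akar.
have Ma := cvg_M_div_a phi0 phiy a0 ay akar.
have H_lim (z : R) : 0 < z -> x t / a t @[t --> +oo] --> z ->
    primitive0 h t / a t @[t --> +oo] --> z - z `^ beta * K.
  exact: (forcing_ratio_cvg K0 Mm M0 M_oo phim phi0 am a0 ay Jlim Ma f_cont f_gt0
    fphi xi_gt0 H_gt0 x_sol).
(* So [L^(1 - beta) = K]: [L] is the positive solution of [z = K z^beta]. *)
have LE : Lconst theta beta = K `^ (1 - beta)^-1 by rewrite /Lconst mulrC.
have L0 : 0 < Lconst theta beta by rewrite LE powR_gt0.
split; last first.
  move=> z lam Lz xz _ Hlam.
  have z0 : 0 < z by exact: lt_le_trans Lz.
  have -> : lam = z - z `^ beta * K.
    rewrite -(cvg_lim (@Rhausdorff R) (H_lim z z0 xz)).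
    by apply/esym/cvg_lim => //; exact: Rhausdorff.
  by rewrite /K; ring.
split=> [[z [Lz xz]]|[lam [lam0 Hlam]]].
  have z0 : 0 < z by exact: lt_le_trans Lz.
  have Hl := H_lim z z0 xz.
  exists (z - z `^ beta * K); split => //.
  (* A negative limit would make [H] negative at some large time. *)
  rewrite leNgt; apply/negP => neg.
  have neg' : \forall t \near +oo, primitive0 h t / a t < 0 by exact: (cvgr_lt _ Hl).
  near (pinfty_nbhs R) => t.
  have t0 : 0 < t by near: t; apply: nbhs_pinfty_gt; rewrite num_real.
  have : primitive0 h t / a t < 0 by near: t.
  by rewrite ltNge divr_ge0// ltW// H_gt0.
have [z [z0 zE xz]] := sol_ratio_cvg beta_ge0 beta_lt1 K0 Mm M0 M_oo phim phi0 am a0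
  ay adbl Jlim Ma f_cont f_gt0 fphi xi_gt0 H_gt0 x_sol lam0 Hlam.
exists z; split => //.
(* Since [lam >= 0], [zE] gives [z >= K z^beta]; dividing by [z^beta] gives [z^(1 - beta) >= K],
   that is [z >= L]. *)
rewrite leNgt LE; apply/negP; rewrite powR_lt_root// => zK.
have : z `^ beta * z `^ (1 - beta) < z `^ beta * K by rewrite ltr_pM2l// powR_gt0.
rewrite -powRD; last by rewrite addrC subrK oner_eq0.
by rewrite addrC subrK powRr1 ?ltW// {1}zE ltNge lerDl lam0.
Unshelve. all: by end_near. Qed.
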